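(* Let $M$ be a smooth manifold and let $L\subset\mathbb{T}_{\mathbb{C}}M$ be a complex Dirac structure whose order is a constant function on $M$. Then the distribution $\widehat{L}=L(\Delta,\omega_\Delta)\subset\mathbb{T}M$ is a real Dirac structure on $M$. Moreover, when the real index of $L$ is zero, so that $L$ is the $+i$-eigenbundle of a generalized complex structure $\mathcal{J}$, $\widehat{L}$ is the graph $\{\pi_{\mathcal{J}}(\alpha)+\alpha \mid \alpha\in T^*M\}$ of the Poisson bivector $\pi_{\mathcal{J}}=\mathrm{pr}_{TM}\circ\mathcal{J}|_{T^*M}$ associated to $\mathcal{J}$.
   Context: $\mathbb{T}M:=TM\oplus T^*M$ carries the pairing $\langle X+\xi,Y+\eta\rangle=\frac12(\eta(X)+\xi(Y))$ and the Dorfman bracket $[X+\xi,Y+\eta]=[X,Y]+\mathcal{L}_X\eta-\imath_Y d\xi$ on sections; $\mathbb{T}_{\mathbb{C}}M$ is its complexification, with the complexified pairing and bracket. A real (resp. complex) Dirac structure is a smooth subbundle $L\subset\mathbb{T}M$ (resp. $L\subset\mathbb{T}_{\mathbb{C}}M$) that is lagrangian ($L=L^\perp$) and involutive ($[\Gamma(L),\Gamma(L)]\subseteq\Gamma(L)$). A distribution in a vector bundle is an assignment of a subspace of the fibre to each point (not necessarily smooth or of constant rank). For a conjugation-invariant complex subspace $F$, $\mathrm{Re}\,F$ denotes its set of real elements. Given a complex Dirac structure $L$, let $E:=\mathrm{pr}_{T_{\mathbb{C}}M}L$ and let $\varepsilon$ be the pointwise skew-symmetric bilinear form on $E$ defined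 by $\varepsilon(X,Y)=\xi(Y)$ for any $X+\xi\in L$, $Y\in E$. Set $\Delta:=\mathrm{Re}(E\cap\overline{E})$, $D:=\mathrm{Re}(E+\overline{E})$ (pointwise subspaces of $TM$), and $\omega_\Delta:=\mathrm{Im}\,(\varepsilon|_{\Delta})\in\wedge^2\Delta^*$. The order of $L$ is the function $\dim M-\mathrm{rank}\,D$, and the real index of $L$ is the function $\mathrm{rank}(L\cap\overline{L})$. Finally, $L(\Delta,\omega_\Delta):=\{X+\xi\in\mathbb{T}M \mid X\in\Delta,\ \xi|_{\Delta}=\imath_X\omega_\Delta\}$. A generalized complex structure is a bundle map $\mathcal{J}:\mathbb{T}M\to\mathbb{T}M$ with $\mathcal{J}^2=-1$, $\mathcal{J}^*=-\mathcal{J}$ whose $+i$-eigenbundle in $\mathbb{T}_{\mathbb{C}}M$ is involutive; equivalently, a complex Dirac structure $L$ (the $+i$-eigenbundle) with $L\cap\overline{L}=0$. *)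

(* Defs.v *)
From HB Require Import structures.
From mathcomp Require Import all_boot all_order all_algebra.
From mathcomp Require Import all_classical all_reals all_analysis.
From mathcomp Require Import complex.
Import Order.TTheory GRing.Theory Num.Theory.
Import numFieldNormedType.Exports.

Set Implicit Arguments.
Unset Strict Implicit.
Unset Printing Implicit Defensive.

Local Open Scope classical_set_scope.
Local Open Scope ring_scope.

(** * Smooth functions on (open) subsets of R^n *)

(* A function is C^(k+1) iff it is Frechet differentiable with C^k partial
   derivatives. *)
Fixpoint Ck (R : realType) (n k : nat) (U : set 'rV[R]_n) (f : 'rV[R]_n -> R)
    : Prop :=
  if k is k'.+1 then
    (forall x, U x -> differentiable f x) /\
    (forall i : 'I_n, Ck k' U (fun x => 'D_(delta_mx 0 i) f x))
  else forall x, U x -> {for x, continuous f}.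

Definition smooth_on (R : realType) (n : nat) (U : set 'rV[R]_n)
    (f : 'rV[R]_n -> R) : Prop :=
  forall k, Ck k U f.

(** * Smooth manifolds *)

Record chart (R : realType) (n : nat) (T : topologicalType) := Chart {
  dom : set T;
  coord : T -> 'rV[R]_n;
  icoord : 'rV[R]_n -> T;
  open_dom : open dom;
  open_codom : open (coord @` dom);
  coord_continuous : forall p, dom p -> {for p, continuous coord};
  icoord_continuous :
    forall x, (coord @` dom) x -> {for x, continuous icoord};
  coordK : forall p, dom p -> icoord (coord p) = p }.

Definition compatible (R : realType) (n : nat) (T : topologicalType)
    (c d : chart R n T) : Prop :=
  forall j : 'I_n, smooth_on (coord c @` (dom c `&` dom d))
                             (fun x => coord d (icoord c x) 0 j).

(* Besides its atlas, a manifold carries a preferred chart around each point;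
   the fibres of TM, T^*M at p are R^n, by means of the coordinates of the
   preferred chart at p. *)
Record manifold (R : realType) (n : nat) := Manifold {
  carrier :> topologicalType;
  atlas : set (chart R n carrier);
  chart_at : carrier -> chart R n carrier;
  manifold_hausdorff : hausdorff_space carrier;
  manifold_second_countable : @second_countable carrier;
  chart_at_atlas : forall p, atlas (chart_at p);
  mem_chart_at : forall p, dom (chart_at p) p;
  atlas_compatible :
    forall c d, atlas c -> atlas d -> compatible c d }.

(** * Linear algebra in the fibres of TM + T^*M and of its complexification *)

Definition fibre (K : fieldType) (n : nat) : vectType K :=
  ('rV[K]_n * 'rV[K]_n)%type.

(* Evaluation xi(X) of a covector on a vector. *)
Definition ev (K : fieldType) (n : nat) (xi X : 'rV[K]_n) : K :=
  \sum_i xi 0 i * X 0 i.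

Definition pairing (K : fieldType) (n : nat) (a b : fibre K n) : K :=
  2%:R^-1 * (ev b.2 a.1 + ev a.2 b.1).

Definition orth (K : fieldType) (n : nat) (S : set (fibre K n)) :
    set (fibre K n) :=
  [set a | forall b, S b -> pairing a b = 0].

(* The dimension of a linear subspace given as a set. *)
Definition rank (K : fieldType) (V : vectType K) (S : set V) : nat :=
  \dim (xget 0%VS [set W : {vspace V} | S = [set v | v \in W]]).

Lemma rank_vspace (K : fieldType) (V : vectType K) (W : {vspace V}) :
  rank [set v | v \in W] = \dim W.
Proof.
rewrite /rank; congr (\dim _); case: xgetP => [U _ /= eqWU|/(_ W)/(_ erefl)] //.
apply/vspaceP => v; apply/idP/idP => vU.
  by have : [set u | u \in U] v by []; rewrite -eqWU.
by have : [set u | u \in W] v by []; rewrite eqWU.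
Qed.

Definition cvec (R : realType) (n : nat) (v : 'rV[R]_n) : 'rV[R[i]]_n :=
  map_mx (fun x => x%:C%C) v.
Definition re_vec (R : realType) (n : nat) (v : 'rV[R[i]]_n) : 'rV[R]_n :=
  map_mx (@complex.Re R) v.
Definition im_vec (R : realType) (n : nat) (v : 'rV[R[i]]_n) : 'rV[R]_n :=
  map_mx (@complex.Im R) v.
Definition conj_vec (R : realType) (n : nat) (v : 'rV[R[i]]_n) :
    'rV[R[i]]_n :=
  map_mx (@conjc R) v.

Definition cfib (R : realType) (n : nat) (a : fibre R n) : fibre R[i] n :=
  (cvec a.1, cvec a.2).
Definition re_fib (R : realType) (n : nat) (a : fibre R[i] n) : fibre R n :=
  (re_vec a.1, re_vec a.2).
Definition im_fib (R : realType) (n : nat) (a : fibre R[i] n) : fibre R n :=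
  (im_vec a.1, im_vec a.2).
Definition conj_fib (R : realType) (n : nat) (a : fibre R[i] n) :
    fibre R[i] n :=
  (conj_vec a.1, conj_vec a.2).

(* Re F, as a set of real vectors. *)
Definition real_part (R : realType) (n : nat) (F : set 'rV[R[i]]_n) :
    set 'rV[R]_n :=
  [set v | F (cvec v)].

(** * Tensor fields in coordinates *)

Section Manifold.
Variables (R : realType) (n : nat) (M : manifold R n).
Implicit Types (p : M) (U : set M) (c : chart R n M).

(* Jacobian at p of the change of coordinates from c to d; vectors are rows,
   so that it sends v to v *m jac c d p. *)
Definition jac c (d : chart R n M) p : 'M[R]_n :=
  jacobian (fun x => coord d (icoord c x)) (coord c p).

(* Components in the chart c of a vector, resp. of a covector, at p. *)
Definition vec_in c p (v : 'rV[R]_n) : 'rV[R]_n :=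
  v *m jac (chart_at p) c p.
Definition cov_in c p (xi : 'rV[R]_n) : 'rV[R]_n :=
  xi *m (jac c (chart_at p) p)^T.

Definition smooth_fun (f : M -> R) : Prop :=
  forall c, atlas c -> smooth_on (coord c @` dom c) (fun x => f (icoord c x)).

Definition smooth_vec U (X : M -> 'rV[R]_n) : Prop :=
  forall c, atlas c -> forall j, smooth_on (coord c @` (U `&` dom c))
    (fun x => vec_in c (icoord c x) (X (icoord c x)) 0 j).

Definition smooth_cov U (xi : M -> 'rV[R]_n) : Prop :=
  forall c, atlas c -> forall j, smooth_on (coord c @` (U `&` dom c))
    (fun x => cov_in c (icoord c x) (xi (icoord c x)) 0 j).

Definition smooth_real U (a : M -> fibre R n) : Prop :=
  smooth_vec U (fun p => (a p).1) /\ smooth_cov U (fun p => (a p).2).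

Definition smooth_complex U (a : M -> fibre R[i] n) : Prop :=
  smooth_real U (fun p => re_fib (a p)) /\ smooth_real U (fun p => im_fib (a p)).

(* (df/dx^i)(p), in the preferred chart at p. *)
Definition pd (i : 'I_n) (f : M -> R) p : R :=
  'D_(delta_mx 0 i) (fun x => f (icoord (chart_at p) x))
     (coord (chart_at p) p).

(* (dX^j/dx^i)(p) and (d xi_j/dx^i)(p): near p the components have to be taken
   in the preferred chart at p, not in those at the neighbouring points. *)
Definition dvec (X : M -> 'rV[R]_n) p (i j : 'I_n) : R :=
  pd i (fun q => vec_in (chart_at p) q (X q) 0 j) p.
Definition dcov (xi : M -> 'rV[R]_n) p (i j : 'I_n) : R :=
  pd i (fun q => cov_in (chart_at p) q (xi q) 0 j) p.

Definition lie_bracket (X Y : M -> 'rV[R]_n) p : 'rV[R]_n :=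
  \row_j \sum_i (X p 0 i * dvec Y p i j - Y p 0 i * dvec X p i j).

Definition lie_derivative (X eta : M -> 'rV[R]_n) p : 'rV[R]_n :=
  \row_j \sum_i (X p 0 i * dcov eta p i j + eta p 0 i * dvec X p j i).

(* The one-form i_Y (d xi). *)
Definition contract_d (Y xi : M -> 'rV[R]_n) p : 'rV[R]_n :=
  \row_j \sum_i Y p 0 i * (dcov xi p i j - dcov xi p j i).

Definition dorfman (a b : M -> fibre R n) p : fibre R n :=
  let X q := (a q).1 in let xi q := (a q).2 in
  let Y q := (b q).1 in let eta q := (b q).2 in
  (lie_bracket X Y p, lie_derivative X eta p - contract_d Y xi p).

Definition dorfman_complex (a b : M -> fibre R[i] n) p : fibre R[i] n :=
  let ra q := re_fib (a q) in let ia q := im_fib (a q) in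
  let rb q := re_fib (b q) in let ib q := im_fib (b q) in
  cfib (dorfman ra rb p - dorfman ia ib p) +
  'i%C *: cfib (dorfman ra ib p + dorfman ia rb p).

(** * Dirac structures *)

Section Dirac.
Variable K : fieldType.
Variable smooth : set M -> (M -> fibre K n) -> Prop.
Variable bracket : (M -> fibre K n) -> (M -> fibre K n) -> M -> fibre K n.
Variable L : M -> set (fibre K n).

Definition smooth_subbundle : Prop :=
  forall p, exists U : set M, open U /\ U p /\
  exists (r : nat) (e : 'I_r -> M -> fibre K n),
    (forall i, smooth U (e i)) /\
    forall q, U q ->
      let frame := [tuple e i q | i < r] in
      free frame /\ L q = [set a | a \in <<frame>>%VS].

Definition lagrangian : Prop := forall p, L p = orth (L p).

Definition global_section (a : M -> fibre K n) : Prop :=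
  smooth setT a /\ forall p, L p (a p).

Definition involutive : Prop :=
  forall a b, global_section a -> global_section b ->
    global_section (bracket a b).

Definition dirac : Prop := [/\ smooth_subbundle, lagrangian & involutive].
End Dirac.

Definition real_dirac (L : M -> set (fibre R n)) : Prop :=
  dirac smooth_real dorfman L.

Definition complex_dirac (L : M -> set (fibre R[i] n)) : Prop :=
  dirac smooth_complex dorfman_complex L.

(** * Distributions associated to a complex Dirac structure *)

Section Associated.
Variable L : M -> set (fibre R[i] n).

Definition E_of p : set 'rV[R[i]]_n := [set a.1 | a in L p].
Definition Ebar_of p : set 'rV[R[i]]_n := [set conj_vec X | X in E_of p].

(* The value at Y of any xi such that X + xi lies in L; see [epsE]. *)
Definition eps p (X Y : 'rV[R[i]]_n) : R[i] :=
  ev (xget 0 [set xi | L p (X, xi)]) Y.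

Definition Delta p : set 'rV[R]_n := real_part (E_of p `&` Ebar_of p).
Definition D_of p : set 'rV[R]_n :=
  real_part [set X + Y | X in E_of p & Y in Ebar_of p].

(* Only meant for X, Y in Delta p. *)
Definition omega p (X Y : 'rV[R]_n) : R :=
  complex.Im (eps p (cvec X) (cvec Y)).

Definition dirac_order p : nat := (n - rank (D_of p))%N.

Definition real_index p : nat :=
  rank (L p `&` [set conj_fib a | a in L p]).

Definition hat_L p : set (fibre R n) :=
  [set a | Delta p a.1 /\
           forall Y, Delta p Y -> ev a.2 Y = omega p a.1 Y].

Lemma epsE p X xi Y : lagrangian L -> L p (X, xi) -> E_of p Y ->
  eps p X Y = ev xi Y.
Proof.
move=> lagL LX [[Y' eta] LY /= eqY]; rewrite -{}eqY {Y}.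
have mulr_eq0P (x : R[i]) : 2%:R^-1 * x = 0 -> x = 0.
  by move/eqP; rewrite mulf_eq0 invr_eq0 pnatr_eq0 => /eqP.
have key z : L p (X, z) -> ev z Y' = - ev eta X.
  rewrite lagL => /(_ _ LY)/mulr_eq0P/eqP /=.
  by rewrite addrC addr_eq0 => /eqP.
rewrite /eps (key _ LX); apply: key.
by have := @xgetI _ 0 [set z | L p (X, z)] _ LX.
Qed.

End Associated.

(** * Generalized complex structures *)

Implicit Type J : M -> 'End(fibre R n).

Definition smooth_bundle_map J : Prop :=
  forall U a, open U -> smooth_real U a -> smooth_real U (fun p => J p (a p)).

Definition complexify (A : 'End(fibre R n)) (a : fibre R[i] n) :
    fibre R[i] n :=
  cfib (A (re_fib a)) + 'i%C *: cfib (A (im_fib a)).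

Definition i_eigenbundle J p : set (fibre R[i] n) :=
  [set a | complexify (J p) a = 'i%C *: a].

Definition generalized_complex J : Prop :=
  [/\ smooth_bundle_map J,
      forall p a, J p (J p a) = - a,
      forall p a b, pairing (J p a) b = - pairing a (J p b) &
      involutive smooth_complex dorfman_complex (i_eigenbundle J)].

(** * Poisson bivectors *)

(* A bivector pi is seen as a skew-symmetric map T^*M -> TM. *)
Definition d_of (f : M -> R) p : 'rV[R]_n := \row_i pd i f p.

Definition poisson_bracket (pi : M -> 'rV[R]_n -> 'rV[R]_n) (f g : M -> R) p
    : R :=
  ev (d_of g p) (pi p (d_of f p)).

Definition is_poisson (pi : M -> 'rV[R]_n -> 'rV[R]_n) : Prop :=
  [/\ forall U xi, open U -> smooth_cov U xi ->
        smooth_vec U (fun p => pi p (xi p)),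
      forall p, linear (pi p),
      forall p xi eta, ev eta (pi p xi) = - ev xi (pi p eta) &
      forall f g h, smooth_fun f -> smooth_fun g -> smooth_fun h -> forall p,
        poisson_bracket pi f (poisson_bracket pi g h) p +
        poisson_bracket pi g (poisson_bracket pi h f) p +
        poisson_bracket pi h (poisson_bracket pi f g) p = 0].

Definition bivector_of J p (alpha : 'rV[R]_n) : 'rV[R]_n := (J p (0, alpha)).1.

Definition graph_of (pi : M -> 'rV[R]_n -> 'rV[R]_n) p : set (fibre R n) :=
  [set (pi p alpha, alpha) | alpha in setT].

End Manifold.

(* Main.v *)
(* The distribution L(Delta, omega_Delta) at p consists of the X + Im zeta with
   X real and X + zeta in L.  This set is lagrangian at each point: it is clearly
   isotropic, and an element orthogonal to it is completed to an element of
   L = L^perp by solving for the real part of zeta.  The elements of L with real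
   vector part are the kernel of the real linear map Im o pr_T on L, whose image
   is D; as the order is constant, this map has constant rank, so its kernel has
   smooth local frames.  Hence a section of L(Delta, omega_Delta) locally lifts
   to a section of L with real vector part, which a cutoff function makes global;
   the imaginary cotangent part of the Dorfman bracket of two lifts is that of
   the bracket of the sections, so both the involutivity and the smoothness of
   the latter come from those of L.

   When the real index is zero, Re : L -> TM + T^*M is an isomorphism and
   J (Re l) = - Im l.  An element of L with real vector part has imaginary part
   (0, alpha) and real part J (0, alpha), whence the graph.  The Jacobi identity
   says that the Dorfman bracket of the sections pi(df) + df and pi(dg) + dg is
   orthogonal to pi(dh) + dh. *)
From HB Require Import structures.
Require Import Defs.
From mathcomp Require Import all_boot all_order all_algebra perm.
From mathcomp Require Import all_classical all_reals all_analysis.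
From mathcomp Require Import complex ring.
Import Order.TTheory GRing.Theory Num.Theory.
Import numFieldNormedType.Exports.
(* [coord] must be the one of Defs, not the one of vector.v. *)
Import Defs.

Set Implicit Arguments.
Unset Strict Implicit.
Unset Printing Implicit Defensive.

Local Open Scope classical_set_scope.
Local Open Scope ring_scope.

(** * Smooth functions on open sets of R^n *)

(** Solving for the real part of zeta is a factorisation problem: orthogonality to L prescribes the
    unknown covector on the real vector parts of elements of L. Orthogonality to L(Delta,
    omega_Delta) is exactly what makes this prescription single-valued, and linear algebra extends
    it to a covector. For the frames, the lifts cannot be a whole basis of the kernel of Im o pr_T:
    passing to X + Im zeta kills the real covectors in L. So n kernel elements are chosen at one
    point, with images forming a basis there, and are carried to nearby points by a projection onto
    the kernel whose entries are rational in those of a smooth matrix; constancy of the rank makes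
    it a projection onto the kernel. Independence is an open condition, and since a lagrangian
    subspace has dimension n, n independent elements span it at nearby points too. The fibre at a
    point is read in the preferred chart of that point, and this chart may jump. Hence every
    smoothness argument first passes to components in one fixed chart. *)

Lemma near_eq_differentiable (R : realFieldType) (V W : normedModType R)
    (f g : V -> W) (x : V) :
  (\forall y \near x, f y = g y) -> differentiable f x -> differentiable g x.
Proof.
move=> fg df.
have gE : g \o shift x = cst (g x) + 'd f x +o_ 0 id.
  apply/eqaddoP => e e0; have := diff_locally df => /eqaddoP /(_ e e0).
  apply: filterS2; last first.
    have : \forall y \near x, f y = g y by [].
    by rewrite (near_shift 0 x) /=; apply.
  move=> y /=; rewrite subr0 => E.
  by rewrite /cst /= !fctE /= (nbhs_singleton fg) E.
have dgE : 'd g x = 'd f x :> (V -> W).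
  by apply: diff_unique gE; exact: diff_continuous.
by apply/diff_locallyP; rewrite dgE; split; first exact: diff_continuous.
Qed.

Section Calculus.
Variable R : realType.
Implicit Types (n k : nat).

Lemma Ck_sub n k (U V : set 'rV[R]_n) f : V `<=` U -> Ck k U f -> Ck k V f.
Proof.
move=> VU; elim: k f => [|k IH] f /= H; first by move=> x /VU /H.
by case: H => H1 H2; split=> [x /VU /H1 //|i]; apply: IH.
Qed.

(** Since [Ck] differentiates total functions and [U] need not be open, agreement is required near
    each point of [U]; [near_join] passes it on to the partial derivatives. *)
Lemma near_eq_Ck n k (U : set 'rV[R]_n) f g :
  (forall x, U x -> \forall y \near x, f y = g y) -> Ck k U f -> Ck k U g.
Proof.
elim: k f g => [|k IH] f g fg /=.
  move=> H x Ux; have := H x Ux; rewrite /prop_for /continuous_at.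
  rewrite (nbhs_singleton (fg _ Ux)); apply: cvg_trans.
  exact: (near_eq_cvg (fg _ Ux)).
move=> [H1 H2]; split=> [x Ux|i]; first exact: near_eq_differentiable (fg _ Ux)
  (H1 _ Ux).
apply: (IH _ _ _ (H2 i)) => x /fg /near_join; apply: filterS => y.
exact: near_eq_derive.
Qed.

Lemma CkS n k (U : set 'rV[R]_n) f : Ck k.+1 U f -> Ck k U f.
Proof.
elim: k f => [|k IH] f [H1 H2]; first by move=> x /H1 /differentiable_continuous.
by split=> // i; apply: IH.
Qed.

Lemma Ck_differentiable n k (U : set 'rV[R]_n) f x :
  Ck k.+1 U f -> U x -> differentiable f x.
Proof. by case=> H _ /H. Qed.

Lemma Ck_derive n k (U : set 'rV[R]_n) f i :
  Ck k.+1 U f -> Ck k U ('D_(delta_mx 0 i) f).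
Proof. by case=> _; apply. Qed.

(* The openness of the domain is what allows to differentiate the identity
   between a derivative and its formula. *)
Lemma Ck_step n k (U : set 'rV[R]_n) (f : 'rV_n -> R) (df : 'I_n -> 'rV_n -> R) :
  open U ->
  (forall x, U x -> differentiable f x) ->
  (forall i x, U x -> 'D_(delta_mx 0 i) f x = df i x) ->
  (forall i, Ck k U (df i)) -> Ck k.+1 U f.
Proof.
move=> Uo H1 H2 H3; split=> // i; apply: near_eq_Ck (H3 i) => x Ux.
have : \forall y \near x, U y by apply: open_nbhs_nbhs; split.
by apply: filterS => y /H2 ->.
Qed.

Lemma Ck_cst n k (U : set 'rV[R]_n) (a : R) : Ck k U (fun=> a).
Proof.
elim: k a => [|k IH] a /=; first by move=> x _;
  exact: (differentiable_continuous (differentiable_cst a x)).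
split=> [x _|i]; first exact: differentiable_cst.
rewrite (_ : 'D__ _ = fun=> 0); first exact: IH.
by apply/funext => x; exact: derive_cst.
Qed.

Lemma Ck_add n k (U : set 'rV[R]_n) (f g : 'rV_n -> R) : open U ->
  Ck k U f -> Ck k U g -> Ck k U (fun x => f x + g x).
Proof.
move=> Uo; elim: k f g => [|k IH] f g Hf Hg.
  by move=> x Ux; exact: (cvgD (Hf _ Ux) (Hg _ Ux)).
have [[H1 _] [H3 _]] := (Hf, Hg).
apply: (Ck_step Uo (df := fun i x => 'D_(delta_mx 0 i) f x + 'D_(delta_mx 0 i)
  g x)).
- by move=> x Ux; apply: differentiableD; [apply: H1|apply: H3].
- by move=> i x Ux; apply: deriveD; apply: diff_derivable; [apply: H1|apply: H3].
- by move=> i; exact: (IH _ _ (Ck_derive _ Hf) (Ck_derive _ Hg)).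
Qed.

Lemma Ck_mul n k (U : set 'rV[R]_n) (f g : 'rV_n -> R) : open U ->
  Ck k U f -> Ck k U g -> Ck k U (fun x => f x * g x).
Proof.
move=> Uo; elim: k f g => [|k IH] f g Hf Hg.
  by move=> x Ux; exact: (cvgM (Hf _ Ux) (Hg _ Ux)).
have [[H1 _] [H3 _]] := (Hf, Hg).
apply: (Ck_step Uo (df := fun i x => f x * 'D_(delta_mx 0 i) g x + g x *
  'D_(delta_mx 0 i) f x)).
- by move=> x Ux; apply: differentiableM; [apply: H1|apply: H3].
- by move=> i x Ux; apply: deriveM; apply: diff_derivable; [apply: H1|apply: H3].
- move=> i; apply: Ck_add => //.
    exact: (IH _ _ (CkS Hf) (Ck_derive _ Hg)).
  exact: (IH _ _ (CkS Hg) (Ck_derive _ Hf)).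
Qed.

Lemma Ck_sum n k (U : set 'rV[R]_n) (I : Type) (r : seq I) (P : pred I)
    (f : I -> 'rV_n -> R) : open U ->
  (forall i, P i -> Ck k U (f i)) -> Ck k U (fun x => \sum_(i <- r | P i) f i x).
Proof.
move=> Uo H; elim: r => [|i r IH].
  by rewrite (_ : (fun x => _) = fun=> 0); [exact: Ck_cst|apply/funext => x;
    rewrite big_nil].
case: (boolP (P i)) => Pi.
  rewrite (_ : (fun x => _) = fun x => f i x + \sum_(j <- r | P j) f j x).
    by apply: Ck_add => //; apply: H.
  by apply/funext => x; rewrite big_cons Pi.
by rewrite (_ : (fun x => _) = fun x => \sum_(j <- r | P j) f j x) //;
   apply/funext => x; rewrite big_cons (negPf Pi).
Qed.

Lemma Ck_prod n k (U : set 'rV[R]_n) (I : Type) (r : seq I)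
    (f : I -> 'rV_n -> R) : open U ->
  (forall i, Ck k U (f i)) -> Ck k U (fun x => \prod_(i <- r) f i x).
Proof.
move=> Uo H; elim: r => [|i r IH].
  by rewrite (_ : (fun x => _) = fun=> 1); [exact: Ck_cst|apply/funext => x;
    rewrite big_nil].
rewrite (_ : (fun x => _) = fun x => f i x * \prod_(j <- r) f j x).
  by apply: Ck_mul => //; apply: H.
by apply/funext => x; rewrite big_cons.
Qed.

Lemma Ck_inv n k (U : set 'rV[R]_n) (f : 'rV_n -> R) : open U ->
  (forall x, U x -> f x != 0) -> Ck k U f -> Ck k U (fun x => (f x)^-1).
Proof.
move=> Uo f0; elim: k => [|k IH] Hf.
  by move=> x Ux; exact: (cvgV (f0 _ Ux) (Hf _ Ux)).
have Hi := IH (CkS Hf); have [H1 H2] := Hf.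
apply: (Ck_step Uo (df := fun i x => -1 * ((f x)^-1 * (f x)^-1 * 'D_(delta_mx 0
  i) f x))).
- by move=> x Ux; apply: differentiableV; [apply: H1|apply: f0].
- move=> i x Ux; rewrite deriveV; [|exact: f0|by apply: diff_derivable;
  apply: H1].
  by rewrite /GRing.scale /= expr2 invfM mulN1r mulNr.
- move=> i; apply: Ck_mul => //; first exact: Ck_cst.
  by apply: Ck_mul => //; [apply: Ck_mul|exact: Ck_derive].
Qed.

Lemma differentiable_rV n m (f : 'rV[R]_n -> 'rV[R]_m) x :
  (forall j, differentiable (fun y => f y 0 j) x) -> differentiable f x.
Proof.
move=> H.
rewrite (_ : f = \sum_(j < m) (fun y => f y 0 j *: delta_mx 0 j)).
  by apply: differentiable_sum => j; apply: differentiableZl.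
by apply/funext => y; rewrite fct_sumE; apply: row_sum_delta.
Qed.

Lemma derive_comp n m (f : 'rV[R]_m -> R) (h : 'rV[R]_n -> 'rV[R]_m) x v :
  (forall j, differentiable (fun y => h y 0 j) x) ->
  differentiable f (h x) ->
  'D_v (fun y => f (h y)) x =
    \sum_j 'D_(delta_mx 0 j) f (h x) * 'D_v (fun y => h y 0 j) x.
Proof.
move=> H df; have dh := differentiable_rV H.
rewrite (_ : (fun y => _) = f \o h) // deriveE; last exact: differentiable_comp.
rewrite diff_comp //= -[X in 'd f _ X]deriveE // derive_mx;
  last exact: diff_derivable.
set w := (\matrix_(i, j) _ : 'rV_m).
rewrite [w]row_sum_delta linear_sum; apply: eq_bigr => j _.
by rewrite linearZ /= mulrC -deriveE // /w mxE.
Qed.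

(** The chain rule expresses the partial derivatives through those of [f] and [h], to which the
    induction applies. The extra order on [h] makes it differentiable, hence continuous, already at
    [k = 0]. *)
Lemma Ck_comp n m k (U : set 'rV[R]_n) (V : set 'rV[R]_m) (f : 'rV[R]_m -> R)
    (h : 'rV[R]_n -> 'rV[R]_m) : open U ->
  (forall x, U x -> V (h x)) -> (forall j, Ck k.+1 U (fun x => h x 0 j)) ->
  Ck k V f -> Ck k U (fun x => f (h x)).
Proof.
move=> Uo UV; elim: k f => [|k IH] f Hh Hf.
  move=> x Ux; apply: continuous_comp; last by apply: Hf; exact: UV.
  apply: differentiable_continuous; apply: differentiable_rV => j.
  exact: Ck_differentiable (Hh j) Ux.
have [H1 H2] := Hf.
apply: (Ck_step Uo (df := fun i x => \sum_j 'D_(delta_mx 0 j) f (h x) *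
  'D_(delta_mx 0 i) (fun y => h y 0 j) x)).
- move=> x Ux; apply: (@differentiable_comp _ _ _ _ h f).
    by apply: differentiable_rV => j; exact: Ck_differentiable (Hh j) Ux.
  by apply: H1; apply: UV.
- move=> i x Ux; apply: derive_comp => [j|]; last by apply: H1; apply: UV.
  exact: Ck_differentiable (Hh j) Ux.
- move=> i; apply: Ck_sum => // j _; apply: Ck_mul => //.
    exact: (IH _ (fun j' => CkS (Hh j')) (Ck_derive _ Hf)).
  exact: (CkS (Ck_derive _ (Hh j))).
Qed.

End Calculus.

Section Smooth.
Variable R : realType.
Implicit Types (n k : nat).

(** Derivatives are taken of total functions and only evaluated on [U], so [Ck] is a conjunction
    over the points of [U]. Locality of smoothness follows without any openness. *)
Lemma Ck_pointwise n k (U : set 'rV[R]_n) f :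
  (forall x, U x -> Ck k [set x] f) -> Ck k U f.
Proof.
elim: k f => [|k IH] f H; first by move=> x /H; apply.
split=> [x /H [+ _]|i]; first by apply.
by apply: IH => x /H/Ck_derive; apply.
Qed.

Lemma smooth_on_local n (U : set 'rV[R]_n) f :
  (forall x, U x -> exists V, V x /\ smooth_on V f) -> smooth_on U f.
Proof.
move=> H k; apply: Ck_pointwise => x /H[V [Vx Vf]].
by apply: Ck_sub (Vf k) => _ ->.
Qed.

Lemma smooth_on_sub n (U V : set 'rV[R]_n) f :
  V `<=` U -> smooth_on U f -> smooth_on V f.
Proof. by move=> VU Uf k; apply: Ck_sub (Uf k). Qed.

Lemma near_eq_smooth_on n (U : set 'rV[R]_n) f g :
  (forall x, U x -> \forall y \near x, f y = g y) ->
  smooth_on U f -> smooth_on U g.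
Proof. by move=> fg Uf k; apply: near_eq_Ck (Uf k). Qed.

Lemma eq_smooth_on n (U : set 'rV[R]_n) f g : open U ->
  (forall x, U x -> f x = g x) -> smooth_on U f -> smooth_on U g.
Proof.
move=> Uo fg; apply: near_eq_smooth_on => x Ux.
have : \forall y \near x, U y by apply: open_nbhs_nbhs; split.
exact: filterS.
Qed.

Lemma smooth_on_derive n (U : set 'rV[R]_n) f i :
  smooth_on U f -> smooth_on U ('D_(delta_mx 0 i) f).
Proof. by move=> Uf k; exact: Ck_derive (Uf k.+1). Qed.

Lemma smooth_on_differentiable n (U : set 'rV[R]_n) f x :
  smooth_on U f -> U x -> differentiable f x.
Proof. by move=> Uf; exact: Ck_differentiable (Uf 1). Qed.

Lemma smooth_on_coord n (U : set 'rV[R]_n) j : smooth_on U (fun x => x 0 j).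
Proof.
case=> [|k]; first by move=> x _; exact: matrix_normedtype.coord_continuous.
split=> [x _|i]; first exact: differentiable_coord.
rewrite (_ : 'D__ _ = fun=> (delta_mx 0 i : 'rV[R]_n) 0 j); first exact: Ck_cst.
apply/funext => x; have := derive_id x (delta_mx 0 i : 'rV[R]_n).
by move=> {2}<-; rewrite derive_mx ?mxE //; exact: derivable_id.
Qed.

End Smooth.

(** * Symmetry of second derivatives *)

Section Schwarz.
Variables (R : realType) (V : normedModType R).
Implicit Types (f : V -> R) (x y u v : V).

Lemma is_derive_line f y u (s : R) : derivable f (y + s *: u) u ->
  is_derive s 1 (fun t => f (y + t *: u)) ('D_u f (y + s *: u)).
Proof.
move=> df.
have E : (fun h : R => h^-1 *: (((fun t => f (y + t *: u)) \o shift s) (h *: 1) -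
    f (y + s *: u))) =
  (fun h : R => h^-1 *: ((f \o shift (y + s *: u)) (h *: u) - f (y + s *: u))).
  apply/funext => h /=; congr (_ *: (f _ - _)).
  by rewrite [_ *: 1]mulr1 scalerDl addrCA.
by apply: DeriveDef; rewrite /derivable /derive E.
Qed.

Lemma MVT_line f y u (h : R) : 0 < h ->
  (forall t : R, 0 <= t <= h -> derivable f (y + t *: u) u) ->
  exists2 t : R, 0 <= t <= h & f (y + h *: u) - f y = 'D_u f (y + t *: u) * h.
Proof.
move=> h0 H.
pose F (t : R) : R := f (y + t *: u).
pose F' (t : R) : R := 'D_u f (y + t *: u).
have D (t : R) : t \in `[0, h] -> is_derive t 1 F (F' t).
  by rewrite in_itv /= => th; apply: is_derive_line; apply: H.
have D' (t : R) : t \in `]0, h[ -> is_derive t 1 F (F' t).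
  by move=> th; apply: D; apply: subset_itv_oo_cc.
have cF : {within `[0, h], continuous F}.
  by apply: derivable_within_continuous => t /D [].
have [t] := MVT_segment (ltW h0) D' cF.
by rewrite in_itv /= subr0 /F scale0r addr0 => th E; exists t.
Qed.

(** The mean value theorem is applied twice: along [u] to the increment [F] of [f] over [h *: v],
    then along [v] to ['D_u f]. *)
Lemma second_difference f x u v (h : R) : 0 < h ->
  (forall s t : R, 0 <= s <= h -> 0 <= t <= h ->
     differentiable f (x + s *: u + t *: v) /\
     differentiable ('D_u f) (x + s *: u + t *: v)) ->
  exists s t : R, [/\ 0 <= s <= h, 0 <= t <= h &
    f (x + h *: u + h *: v) - f (x + h *: u) - f (x + h *: v) + f x =
    'D_v ('D_u f) (x + s *: u + t *: v) * h * h].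
Proof.
move=> h0 H.
have h1 : 0 <= h <= h by rewrite lexx ltW.
have h2 : 0 <= (0 : R) <= h by rewrite lexx ltW.
pose F y := f (y + h *: v) - f y.
have dF (s : R) : 0 <= s <= h ->
  is_derive (x + s *: u) u F ('D_u f (x + s *: u + h *: v) - 'D_u f (x + s *: u)).
  move=> sh; apply: is_deriveB.
    have [D _] := H s h sh h1.
    have E : (fun k : R => k^-1 *: (((fun y =>
      f (y + h *: v)) \o shift (x + s *: u)) (k *: u) -
       f (x + s *: u + h *: v))) =
     (fun k : R => k^-1 *: ((f \o shift (x + s *: u + h *: v)) (k *: u) -
        f (x + s *: u + h *: v))).
      by apply/funext => k /=; rewrite -addrA.
    have D' : derivable f (x + s *: u + h *: v) u by exact: diff_derivable.
    by apply: DeriveDef; rewrite /derivable /derive E.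
  have [D _] := H s 0 sh h2; rewrite scale0r addr0 in D.
  by apply: DeriveDef => //; exact: diff_derivable.
have [|s sh E1] := @MVT_line F x u h h0; first by move=> t th; have [] := dF t th.
have [|t th E2] := @MVT_line ('D_u f) (x + s *: u) v h h0.
  by move=> t th; apply: diff_derivable; have [] := H s t sh th.
exists s, t; split=> //.
move: E1; have [_ ->] := dF s sh; rewrite E2 => <-; rewrite /F.
by rewrite opprB !addrA addrAC.
Qed.

(** The second difference is symmetric in [u] and [v], so the two mixed derivatives take equal
    values at two points close to [x]. If they differed at [x], continuity with tolerance [e], half
    their distance, would contradict this. *)
Lemma deriveC f x u v (U : set V) : open U -> U x ->
  (forall y, U y -> [/\ differentiable f y, differentiable ('D_u f) y
                      & differentiable ('D_v f) y]) ->
  {for x, continuous ('D_v ('D_u f))} -> {for x, continuous ('D_u ('D_v f))} ->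
  'D_v ('D_u f) x = 'D_u ('D_v f) x.
Proof.
move=> Uo Ux H cA cB; apply: contrapT => /eqP.
set A := 'D_v ('D_u f) in cA *; set B := 'D_u ('D_v f) in cB *.
rewrite -subr_eq0 -normr_gt0 => AB; pose e := `|A x - B x| / 2.
have e0 : 0 < e by rewrite divr_gt0.
have : \forall y \near x, [/\ U y, `|A x - A y| < e & `|B x - B y| < e].
  have n1 : \forall y \near x, U y by apply: open_nbhs_nbhs; split.
  have n2 : \forall y \near x, `|A x - A y| < e by move/cvgrPdist_lt : cA =>
    /(_ _ e0).
  have n3 : \forall y \near x, `|B x - B y| < e by move/cvgrPdist_lt : cB =>
    /(_ _ e0).
  by apply: filterS3 n1 n2 n3.
move=> /nbhs_ballP[d /= d0 dH].
have c0 : 0 < `|u| + `|v| + 1 by rewrite ltr_wpDl // addr_ge0.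
(* This keeps the whole parallelogram spanned by [h *: u] and [h *: v] at [x] inside the ball of
   radius [d]; the 1 makes the denominator positive and the inclusion strict. *)
pose h := d / (`|u| + `|v| + 1).
have h0 : 0 < h by rewrite divr_gt0.
have near (s t : R) : 0 <= s <= h -> 0 <= t <= h ->
  ball x d (x + s *: u + t *: v).
  move=> /andP[s0 sh] /andP[t0 th]; rewrite -ball_normE /= -addrA opprD addNKr
    normrN.
  apply: (le_lt_trans (ler_normD _ _)); rewrite !normrZ !ger0_norm //.
  have -> : d = h * (`|u| + `|v| + 1) by rewrite divfK ?gt_eqF.
  rewrite mulrDr mulr1 ltr_pwDr // mulrDr lerD // ler_wpM2r //.
have [|s [t [sh th E]]] := @second_difference f x u v h h0 _.
  by move=> s t sh th; have [/H[? ? _] _ _] := dH _ (near _ _ sh th).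
have [|s' [t' [sh' th' E']]] := @second_difference f x v u h h0 _.
  move=> s' t' sh' th'; rewrite addrAC.
  by have [/H[? _ ?] _ _] := dH _ (near _ _ th' sh').
have EQ : A (x + s *: u + t *: v) = B (x + t' *: u + s' *: v).
  have hN : h != 0 by rewrite gt_eqF.
  apply: (mulIf hN); apply: (mulIf hN).
  rewrite (addrAC x (t' *: u)); apply: (eq_trans (esym E));
    apply: (eq_trans _ E').
  by rewrite (addrAC x (h *: v)) (addrAC (f _)).
have tri (a b c : R) : `|a - b| <= `|a - c| + `|b - c|.
  by rewrite (distrC b) ler_distD.
have [_ a1 _] := dH _ (near _ _ sh th).
have [_ _ b1] := dH _ (near _ _ th' sh').
rewrite EQ in a1.
have := ltrD a1 b1; rewrite -splitr ltNge => /negP; apply.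
by apply: tri.
Qed.
End Schwarz.

Lemma partialC (R : realType) n (U : set 'rV[R]_n) f x (i j : 'I_n) : open U ->
  smooth_on U f -> U x ->
  'D_(delta_mx 0 j) ('D_(delta_mx 0 i) f) x =
  'D_(delta_mx 0 i) ('D_(delta_mx 0 j) f) x.
Proof.
move=> Uo Uf Ux; have d i' := smooth_on_derive i' Uf.
apply: (deriveC Uo Ux) => [y Uy||].
- by split; apply: smooth_on_differentiable Uy.
- exact: (smooth_on_derive j (d i) 0).
- exact: (smooth_on_derive i (d j) 0).
Qed.

(** * Cutoff functions *)

Section Flat.
Variable R : realType.

(** The powers of the inverse make the family closed under differentiation up to linear
    combinations, so smoothness is one induction on the order, for all [m] at once. *)
Definition flat (m : nat) (t : R) : R :=
  if 0 < t then t^-1 ^+ m * expR (- t^-1) else 0.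

Lemma flat_ge0 m t : 0 <= flat m t.
Proof.
rewrite /flat; case: ifPn => // t0.
by rewrite mulr_ge0 ?expR_ge0 // exprn_ge0 // invr_ge0 ltW.
Qed.

(** With [N = m.+2] and [u = t^-1], the N-th power of [u / N <= expR (u / N)] bounds [expR (- u)] by
    [N ^ N * t ^ N]. Two powers of [t] survive, so the difference quotient of [flat m] at 0 tends to
    0. *)
Lemma flat_le m t : flat m t <= m.+2%:R ^+ m.+2 * t ^+ 2.
Proof.
rewrite /flat; case: ifPn => [t0|_]; last first.
  by rewrite mulr_ge0 ?sqr_ge0 // exprn_ge0.
set N := m.+2; have N0 : (0 : R) < N%:R by rewrite ltr0n.
have u0 : 0 < t^-1 by rewrite invr_gt0.
have : (t^-1 / N%:R) ^+ N <= expR t^-1.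
  rewrite -[in leRHS](divfK (lt0r_neq0 N0) t^-1) expRM_natr lerXn2r ?nnegrE
    ?expR_ge0 //.
    by rewrite divr_ge0 // ltW.
  by apply: le_trans (expR_ge1Dx _); rewrite ler_wpDl.
rewrite expRN -(ler_pM2l (exprn_gt0 N N0)) -exprMn mulrC divfK ?lt0r_neq0 //.
move=> H; rewrite ler_pdivrMr ?expR_gt0 // mulrAC.
have -> : t^-1 ^+ m = t^-1 ^+ N * t ^+ 2.
  by rewrite /N -addn2 exprD -mulrA -exprMn mulVf ?gt_eqF // expr1n mulr1.
by rewrite ler_pM2r // exprn_gt0.
Qed.

Lemma is_derive_flat (m : nat) (t : R) :
  is_derive t 1 (flat m) (flat m.+2 t - m%:R * flat m.+1 t).
Proof.
have [t0|t0|->] := ltrgt0P t.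
- have n0 : \forall s \near t, 0 < s by apply: open_nbhs_nbhs; split;
  [exact: open_gt|].
  have E : \forall s \near t, (s^-1 ^+ m * expR (- s^-1) : R) = flat m s.
    by apply: filterS n0 => s s0; rewrite /flat s0.
  apply: (near_eq_is_derive E).
  have dV : is_derive t 1 (fun s : R => s^-1) (- t ^- 2).
    by apply: DeriveDef; [apply: derivableV; rewrite ?gt_eqF|
       rewrite deriveV ?gt_eqF // derive_id /GRing.scale /= mulr1].
  pose N (s : R) : R := - s^-1.
  have dN : is_derive t 1 N (- - t ^- 2) by exact: is_deriveN dV.
  have dE := is_derive1_comp (is_derive_expR (N t)) dN.
  rewrite (_ : (fun s => _) = (fun s : R => s^-1) ^+ m * (expR \o N)); last first.
    by apply/funext => s; rewrite !fctE.
  apply: is_derive_eq (is_deriveM (is_deriveX m dV) dE) _.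
  rewrite !fctE /flat t0 /N /= /GRing.scale /= -!exprVn.
  by case: m {E} => [|m]; rewrite /= ?exprS; ring.
- have n0 : \forall s \near t, s < 0 by apply: open_nbhs_nbhs; split;
  [exact: open_lt|].
  have E : \forall s \near t, (0 : R) = flat m s.
    by apply: filterS n0 => s s0; rewrite /flat ltNge ltW.
  apply: (near_eq_is_derive E).
  by rewrite /flat ltNge ltW //= mulr0 subr0; exact: is_derive_cst.
- rewrite {2 3}/flat ltxx mulr0 subr0.
  have cv : (fun h : R => h^-1 *: ((flat m \o shift 0) (h *: 1) - flat m 0)) @
    0^' --> (0 : R).
    apply/cvgrPdist_le => e e0.
    set C : R := m.+2%:R ^+ m.+2.
    have C0 : 0 < C by rewrite exprn_gt0.
    have n0 : \forall h \near (0 : R)^', `|h| <= e / C /\ h != 0.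
      by apply: filterS2 (dnbhs0_le (divr_gt0 e0 C0)) (nbhs_dnbhs_neq (0 : R)).
    apply: filterS n0 => h [he h0].
    rewrite sub0r normrN /= addr0 [h *: 1]mulr1 {2}/flat ltxx subr0 [_ *: _]/(_
      * _) normrM.
    rewrite normfV ler_pdivrMl ?normr_gt0 // ger0_norm ?flat_ge0 //.
    apply: le_trans (flat_le _ _) _; rewrite -/C -real_normK ?num_real //.
    by rewrite expr2 mulrCA ler_wpM2l // mulrC -ler_pdivlMr.
  apply: DeriveDef; first by apply/cvg_ex; exists 0.
  by apply/cvg_lim.
Qed.
End Flat.

Section Cutoff.
Variables (R : realType) (n : nat).
Implicit Types (U : set 'rV[R]_n) (f : 'rV[R]_n -> R).

Lemma Ck_flat k m U f : open U -> Ck k U f -> Ck k U (fun x => flat m (f x)).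
Proof.
move=> Uo; elim: k m => [|k IH] m Hf.
  move=> x Ux; apply: continuous_comp; first exact: Hf.
  have [D _] := is_derive_flat m (f x).
  by apply: differentiable_continuous; apply/derivable1_diffP.
have D (t : R) : differentiable (flat m) t.
  by apply/derivable1_diffP; have [] := is_derive_flat m t.
have Hk l : Ck k U (fun x => flat l (f x)) by apply: IH; exact: CkS.
apply: (Ck_step Uo (df := fun i x =>
  (flat m.+2 (f x) + - m%:R * flat m.+1 (f x)) * 'D_(delta_mx 0 i) f x)).
- move=> x Ux; apply: (@differentiable_comp _ _ _ _ f (flat m)) => //.
  exact: Ck_differentiable Hf Ux.
- move=> i x Ux; have df : differentiable f x by exact: Ck_differentiable Hf Ux.
  rewrite deriveE; last exact: (@differentiable_comp _ _ _ _ f (flat m)).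
  rewrite (@diff_comp _ _ _ _ f (flat m)) //= -[X in 'd (flat m) _ X]deriveE //.
  have [D1 E] := is_derive_flat m (f x).
  by rewrite deriv1E // derive1E E [_ *: _]/(_ * _) mulNr mulrC.
- move=> i; apply: Ck_mul => //; last exact: Ck_derive.
  by apply: Ck_add => //; apply: Ck_mul => //; exact: Ck_cst.
Qed.

(* [q] is the square of the Euclidean distance to [x0], whereas the norm of
   ['rV_n] is the supremum norm; the two profiles never vanish together. *)
Lemma cutoff (x0 : 'rV[R]_n) (r : R) : 0 < r ->
  exists f, [/\ smooth_on setT f, forall x, r <= `|x0 - x| -> f x = 0
              & \forall x \near x0, f x = 1].
Proof.
move=> r0; pose q (x : 'rV[R]_n) : R := \sum_j (x 0 j + - x0 0 j) * (x 0 j + -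
  x0 0 j).
have qs : smooth_on setT q.
  move=> k; apply: Ck_sum => [|j _]; first exact: openT.
  by apply: Ck_mul; first exact: openT; apply: Ck_add; try exact: openT;
    try exact: Ck_cst; apply: smooth_on_coord.
pose s : R := (r / 2) ^+ 2.
have sr : s < r ^+ 2.
  by rewrite ltrXn2r ?nnegrE ?ltW ?divr_gt0 // ltr_pdivrMr // mulr_natr mulr2n
    ltrDr.
pose a x := flat 0 (r ^+ 2 + -1 * q x); pose b x := flat 0 (q x + - s).
have as_ : smooth_on setT a.
  move=> k; apply: Ck_flat; first exact: openT.
  apply: Ck_add; [exact: openT|exact: Ck_cst|apply: Ck_mul].
  - exact: openT.
  - exact: Ck_cst.
  - exact: qs.
have bs : smooth_on setT b.
  move=> k; apply: Ck_flat; first exact: openT.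
  by apply: Ck_add; [exact: openT|exact: qs|exact: Ck_cst].
have flat_gt0 (t : R) : 0 < t -> 0 < flat 0 t.
  by move=> t0; rewrite /flat t0 expr0 mul1r expR_gt0.
have flat_eq0 (t : R) : t <= 0 -> flat 0 t = 0.
  by move=> t0; rewrite /flat ltNge t0.
have ab x : a x + b x != 0.
  rewrite gt_eqF //; case: (ltP (q x) (r ^+ 2)) => H.
    by rewrite ltr_pwDl ?flat_ge0 // flat_gt0 // mulN1r subr_gt0.
  by rewrite ltr_wpDl ?flat_ge0 // flat_gt0 // subr_gt0 (lt_le_trans sr).
exists (fun x => a x * (a x + b x)^-1); split.
- move=> k; apply: Ck_mul; [exact: openT|exact: as_|apply: Ck_inv => //;
  first exact: openT].
  by apply: Ck_add => //; exact: openT.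
(* Each squared coordinate difference is at most [q x], so [q x < r ^+ 2] would put [x] in the ball
   of radius [r] for the supremum norm. *)
- move=> x rx; rewrite {1}/a flat_eq0 ?mul0r // mulN1r subr_le0 leNgt.
  apply/negP => qr; move: rx; rewrite leNgt => /negP; apply.
  have : ball x0 r x.
    split=> // i j; rewrite ord1 -ball_normE /= distrC.
    rewrite -(@ltr_pXn2r _ 2) ?nnegrE ?(ltW r0) // real_normK ?num_real //.
    apply: le_lt_trans qr; rewrite /q (bigD1 j) //= expr2 lerDl.
    by apply: sumr_ge0 => l _; rewrite -expr2 sqr_ge0.
  by rewrite -ball_normE.
- have cq : {for x0, continuous q} by exact: (qs 0).
  have q0 : q x0 = 0 by rewrite /q big1 // => j _; rewrite subrr mul0r.
  have : \forall x \near x0, q x < s.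
    by apply: (cvgr_lt _ cq); rewrite q0 exprn_gt0 // divr_gt0.
  apply: filterS => x xs; have : b x = 0 by rewrite /b flat_eq0 // subr_le0 ltW.
  by move: (ab x) => /[swap] ->; rewrite addr0 => a0; rewrite divff.
Qed.
End Cutoff.

(** * Charts, smooth functions and smooth sections *)

Lemma derive_derive (R : realType) (U V W : normedModType R) (f : U -> V)
    (g : V -> W) x v : differentiable f x -> differentiable g (f x) ->
  'D_('D_v f x) g (f x) = 'D_v (g \o f) x.
Proof.
move=> df dg; have dgf : differentiable (g \o f) x by exact: differentiable_comp.
by rewrite (deriveE _ dg) (deriveE _ df) (deriveE _ dgf) (diff_comp df dg).
Qed.

Section Charts.
Variables (R : realType) (n : nat) (M : manifold R n).
Implicit Types (p q : M) (U V : set M) (c d e : chart R n M) (f g : M -> R).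

Lemma icoordK c x : (coord c @` dom c) x -> coord c (icoord c x) = x.
Proof. by case=> p cp <-; rewrite coordK. Qed.

Lemma icoord_dom c x : (coord c @` dom c) x -> dom c (icoord c x).
Proof. by case=> p cp <-; rewrite coordK. Qed.

Lemma imcoordP c U x : (coord c @` (U `&` dom c)) x <->
  (coord c @` dom c) x /\ U (icoord c x).
Proof.
split=> [[p [Up cp] <-]|[[p cp <-] Ux]].
  by rewrite coordK //; split=> //; exists p.
by rewrite coordK // in Ux; exists p.
Qed.

Lemma open_imcoord c U : open U -> open (coord c @` (U `&` dom c)).
Proof.
move=> Uo; rewrite openE => x /imcoordP[cx Ux].
have n1 : \forall y \near x, (coord c @` dom c) y.
  by apply: open_nbhs_nbhs; split=> //; exact: open_codom.
have n2 : \forall y \near x, U (icoord c y).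
  by apply: (icoord_continuous cx); apply: open_nbhs_nbhs; split.
by apply: filterS2 n1 n2 => y cy Uy; apply/imcoordP.
Qed.

Definition smooth_in c U f : Prop :=
  smooth_on (coord c @` (U `&` dom c)) (fun x => f (icoord c x)).

Lemma smooth_in_sub c U V f : V `<=` U -> smooth_in c U f -> smooth_in c V f.
Proof. by move=> VU; apply: smooth_on_sub; apply: image_subset => p [/VU]. Qed.

Lemma smooth_in_local c U f :
  (forall p, U p -> exists V, V p /\ smooth_in c V f) -> smooth_in c U f.
Proof.
move=> H; apply: smooth_on_local => x /imcoordP[cx /H [V [Vx Vf]]].
by exists (coord c @` (V `&` dom c)); split=> //; apply/imcoordP.
Qed.

Lemma eq_smooth_in c U f g : open U -> (forall p, U p -> f p = g p) ->
  smooth_in c U f -> smooth_in c U g.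
Proof.
move=> Uo fg; apply: eq_smooth_on; first exact: open_imcoord.
by move=> x /imcoordP[_ /fg].
Qed.

Lemma smooth_in_cst c U (a : R) : smooth_in c U (fun=> a).
Proof. by move=> k; exact: Ck_cst. Qed.

Lemma smooth_in_add c U f g : open U -> smooth_in c U f -> smooth_in c U g ->
  smooth_in c U (fun p => f p + g p).
Proof. by move=> Uo Hf Hg k; apply: Ck_add;
  [exact: open_imcoord|exact: Hf|exact: Hg]. Qed.

Lemma smooth_in_mul c U f g : open U -> smooth_in c U f -> smooth_in c U g ->
  smooth_in c U (fun p => f p * g p).
Proof. by move=> Uo Hf Hg k; apply: Ck_mul;
  [exact: open_imcoord|exact: Hf|exact: Hg]. Qed.

Lemma smooth_in_sum c U (I : Type) (r : seq I) (f : I -> M -> R) : open U ->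
  (forall i, smooth_in c U (f i)) -> smooth_in c U (fun p => \sum_(i <- r) f i p).
Proof.
move=> Uo H k; apply: (@Ck_sum _ _ k _ _ r xpredT (fun i x => f i (icoord c x))).
  exact: open_imcoord.
by move=> i _; exact: H.
Qed.

Lemma smooth_in_prod c U (I : Type) (r : seq I) (f : I -> M -> R) : open U ->
  (forall i, smooth_in c U (f i)) -> smooth_in c U (fun p =>
    \prod_(i <- r) f i p).
Proof.
move=> Uo H k; apply: (@Ck_prod _ _ k _ _ r (fun i x => f i (icoord c x))).
  exact: open_imcoord.
by move=> i; exact: H.
Qed.

Lemma smooth_in_inv c U f : open U -> (forall p, U p -> f p != 0) ->
  smooth_in c U f -> smooth_in c U (fun p => (f p)^-1).
Proof.
move=> Uo f0 Hf k; apply: Ck_inv; [exact: open_imcoord| |exact: Hf].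
by move=> x /imcoordP[_ /f0].
Qed.

(** Composition with a smooth transition map: on an open part of one chart domain, smoothness may be
    tested in that chart alone. *)
Lemma smooth_in_change c d U f : atlas c -> atlas d -> open U -> U `<=` dom c ->
  smooth_in c U f -> smooth_in d U f.
Proof.
move=> ac ad Uo Uc Hf.
have h_in x : (coord d @` (U `&` dom d)) x ->
    (coord d @` (dom d `&` dom c)) x.
  by case=> p [Up dp] <-; exists p; split=> //; exact: Uc.
apply: (@eq_smooth_on _ _ _ (fun x => f (icoord c (coord c (icoord d x))))).
- exact: open_imcoord.
- by move=> x /imcoordP[dx Ux]; rewrite coordK //; exact: Uc.
move=> k; apply: (@Ck_comp _ _ _ _ _ (coord c @` (U `&` dom c))
   (fun y => f (icoord c y)) (fun x => coord c (icoord d x))).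
- exact: open_imcoord.
- by move=> x /imcoordP[dx Ux]; exists (icoord d x) => //; split=> //; exact: Uc.
- move=> j; apply: (Ck_sub h_in).
  exact: (atlas_compatible ad ac).
- exact: Hf.
Qed.

Lemma differentiable_transition c d p : atlas c -> atlas d -> dom c p ->
  dom d p ->
  differentiable (fun x => coord d (icoord c x)) (coord c p).
Proof.
move=> ac ad cp dp; apply: differentiable_rV => j.
by apply: smooth_on_differentiable (atlas_compatible ac ad j) _; exists p.
Qed.

Lemma near_chart c d p : dom c p -> dom d p ->
  \forall x \near coord c p, (coord c @` dom c) x /\ dom d (icoord c x).
Proof.
move=> cp dp; have : open_nbhs (coord c p) (coord c @` (dom d `&` dom c)).
  by split; [apply: open_imcoord; exact: open_dom|exists p].
by move=> /open_nbhs_nbhs; apply: filterS => x /imcoordP.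
Qed.

Lemma jacE c d p v : atlas c -> atlas d -> dom c p -> dom d p ->
  v *m jac c d p = 'D_v (fun x => coord d (icoord c x)) (coord c p).
Proof. by move=> *; rewrite deriveEjacobian //;
  exact: differentiable_transition. Qed.

Lemma jac_comp c d e p : atlas c -> atlas d -> atlas e ->
  dom c p -> dom d p -> dom e p -> jac c d p *m jac d e p = jac c e p.
Proof.
move=> ac ad ae cp dp ep; apply/row_matrixP => i; rewrite !rowE mulmxA.
set v := delta_mx 0 i; set f := fun x => coord d (icoord c x).
pose g := fun x => coord e (icoord d x).
have E : \forall x \near coord c p, coord e (icoord c x) = (g \o f) x.
  by apply: filterS (near_chart cp dp) => x [_ dx]; rewrite /g /f /= coordK.
have fp : f (coord c p) = coord d p by rewrite /f coordK.
have df : differentiable f (coord c p) by exact: differentiable_transition.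
have dg : differentiable g (f (coord c p)).
  by rewrite fp; exact: differentiable_transition.
have Ece : v *m jac c e p = 'D_v (g \o f) (coord c p).
  by apply: (etrans (jacE v ac ae cp ep)); exact: near_eq_derive.
have Ecd : v *m jac c d p = 'D_v f (coord c p) by exact: jacE.
have Ede w : w *m jac d e p = 'D_w g (f (coord c p)) by rewrite fp; exact: jacE.
apply: etrans (esym Ece); apply: etrans (congr1 (mulmx^~ _) Ecd) _.
by apply: etrans (Ede _) _; exact: derive_derive.
Qed.

Lemma jac_id c p : dom c p -> jac c c p = 1%:M.
Proof.
move=> cp; have E : \forall x \near coord c p, x = coord c (icoord c x).
  by apply: filterS (near_chart cp cp) => x [/icoordK].
have D : differentiable (fun x => coord c (icoord c x)) (coord c p).
  exact: near_eq_differentiable E (@ex_diff _ _ _ _ _ _ _ _).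
apply/row_matrixP => i; rewrite !rowE mulmx1 -(deriveEjacobian _ D).
by rewrite -(near_eq_derive _ E) derive_id.
Qed.

Lemma jacK c d p : atlas c -> atlas d -> dom c p -> dom d p ->
  jac c d p *m jac d c p = 1%:M.
Proof. by move=> *; rewrite jac_comp // jac_id. Qed.

End Charts.

Section Sections.
Variables (R : realType) (n : nat) (M : manifold R n).
Implicit Types (p q : M) (U V : set M) (c d e : chart R n M) (f g : M -> R).
Implicit Types (X Y : M -> 'rV[R]_n) (a b : M -> fibre R n).

Lemma vec_inD c p (u v : 'rV[R]_n) : vec_in c p (u + v) =
  vec_in c p u + vec_in c p v.
Proof. exact: mulmxDl. Qed.

Lemma vec_inZ c p k (u : 'rV[R]_n) : vec_in c p (k *: u) = k *: vec_in c p u.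
Proof.
by rewrite /vec_in scalemxAl. Qed.

Lemma cov_inD c p (u v : 'rV[R]_n) : cov_in c p (u + v) =
  cov_in c p u + cov_in c p v.
Proof. exact: mulmxDl. Qed.

Lemma cov_inZ c p k (u : 'rV[R]_n) : cov_in c p (k *: u) = k *: cov_in c p u.
Proof.
by rewrite /cov_in scalemxAl. Qed.

Lemma jac_chart_at c p : atlas c -> dom c p ->
  jac (chart_at p) c p *m jac c (chart_at p) p = 1%:M.
Proof.
by move=> ac cp; apply: jacK => //; [exact: chart_at_atlas|exact:
  mem_chart_at]. Qed.

Lemma vec_in_eq0 c p v : atlas c -> dom c p -> vec_in c p v = 0 -> v = 0.
Proof.
move=> ac cp v0; rewrite -[v]mulmx1 -(jac_chart_at ac cp) mulmxA.
by rewrite -/(vec_in c p v) v0 mul0mx.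
Qed.

Lemma evE (K : fieldType) m (xi v : 'rV[K]_m) : ev xi v = (xi *m v^T) 0 0.
Proof.
by rewrite mxE; apply: eq_bigr => i _; rewrite mxE. Qed.

Lemma ev_in c p xi v : atlas c -> dom c p ->
  ev (cov_in c p xi) (vec_in c p v) = ev xi v.
Proof.
move=> ac cp; rewrite !evE /cov_in /vec_in trmx_mul -mulmxA (mulmxA _^T).
by rewrite -trmx_mul jac_chart_at // trmx1 mul1mx.
Qed.

Lemma vec_in_chart_at p v : vec_in (chart_at p) p v = v.
Proof.
by rewrite /vec_in jac_id ?mulmx1 //; exact: mem_chart_at. Qed.

Lemma cov_in_chart_at p v : cov_in (chart_at p) p v = v.
Proof.
by rewrite /cov_in jac_id ?trmx1 ?mulmx1 //; exact: mem_chart_at. Qed.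

Definition smooth_fun_on U f : Prop := forall c, atlas c -> smooth_in c U f.

Lemma smooth_fun_on_cst U (k : R) : smooth_fun_on U (fun=> k).
Proof.
by move=> c _; exact: smooth_in_cst. Qed.

Lemma smooth_fun_on_sub U V f : V `<=` U -> smooth_fun_on U f ->
  smooth_fun_on V f.
Proof.
by move=> VU H c /H; exact: smooth_in_sub. Qed.

Lemma smooth_fun_on_local U f :
  (forall p, U p -> exists V, V p /\ smooth_fun_on V f) -> smooth_fun_on U f.
Proof.
by move=> H c ac; apply: smooth_in_local => p /H[V [Vp /(_ _ ac) Vf]]; exists V.
Qed.

Lemma eq_smooth_fun_on U f g : open U -> (forall p, U p -> f p = g p) ->
  smooth_fun_on U f -> smooth_fun_on U g.
Proof.
by move=> Uo fg H c /H; exact: eq_smooth_in. Qed.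

Lemma smooth_fun_on_chart c U f : atlas c -> open U -> U `<=` dom c ->
  smooth_in c U f -> smooth_fun_on U f.
Proof.
by move=> ac Uo Uc H d ad; exact: (smooth_in_change ac ad). Qed.

Section Ops.
Variable U : set M.
Hypothesis Uo : open U.

Lemma smooth_fun_on_add f g : smooth_fun_on U f -> smooth_fun_on U g ->
  smooth_fun_on U (fun p => f p + g p).
Proof.
by move=> Hf Hg c ac; apply: smooth_in_add; [exact: Uo|exact: Hf|exact: Hg]. Qed.

Lemma smooth_fun_on_mul f g : smooth_fun_on U f -> smooth_fun_on U g ->
  smooth_fun_on U (fun p => f p * g p).
Proof.
by move=> Hf Hg c ac; apply: smooth_in_mul; [exact: Uo|exact: Hf|exact: Hg]. Qed.

Lemma smooth_fun_on_sum (I : Type) (r : seq I) (F : I -> M -> R) :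
  (forall i, smooth_fun_on U (F i)) ->
  smooth_fun_on U (fun p => \sum_(i <- r) F i p).
Proof.
by move=> HF c ac; apply: smooth_in_sum => // i; exact: HF. Qed.

Lemma smooth_fun_on_prod (I : Type) (r : seq I) (F : I -> M -> R) :
  (forall i, smooth_fun_on U (F i)) ->
  smooth_fun_on U (fun p => \prod_(i <- r) F i p).
Proof.
by move=> HF c ac; apply: smooth_in_prod => // i; exact: HF. Qed.

Lemma smooth_fun_on_inv f : (forall p, U p -> f p != 0) ->
  smooth_fun_on U f -> smooth_fun_on U (fun p => (f p)^-1).
Proof.
by move=> f0 Hf c ac; apply: smooth_in_inv => //; exact: Hf. Qed.

Definition smooth_mx k l (A : M -> 'M[R]_(k, l)) : Prop :=
  forall i j, smooth_fun_on U (fun p => A p i j).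

Lemma smooth_mx_mul k l m (A : M -> 'M[R]_(k, l)) (B : M -> 'M[R]_(l, m)) :
  smooth_mx A -> smooth_mx B -> smooth_mx (fun p => A p *m B p).
Proof.
move=> HA HB i j.
apply: (@eq_smooth_fun_on _ (fun p => \sum_x A p i x * B p x j)) => //.
  by move=> p _; rewrite mxE.
apply: (@smooth_fun_on_sum _ _ (fun x p => A p i x * B p x j)) => x.
exact: smooth_fun_on_mul.
Qed.

Lemma smooth_mx_add k l (A B : M -> 'M[R]_(k, l)) :
  smooth_mx A -> smooth_mx B -> smooth_mx (fun p => A p + B p).
Proof.
move=> HA HB i j; apply: (@eq_smooth_fun_on _ (fun p => A p i j + B p i j)) => //.
  by move=> p _; rewrite mxE.
exact: smooth_fun_on_add.
Qed.

Lemma smooth_mx_scale k l f (A : M -> 'M[R]_(k, l)) :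
  smooth_fun_on U f -> smooth_mx A -> smooth_mx (fun p => f p *: A p).
Proof.
move=> HA HB i j; apply: (@eq_smooth_fun_on _ (fun p => f p * A p i j)) => //.
  by move=> p _; rewrite mxE.
exact: smooth_fun_on_mul.
Qed.

Lemma smooth_mx_cst k l (A : 'M[R]_(k, l)) : smooth_mx (fun=> A).
Proof.
by move=> i j; exact: smooth_fun_on_cst. Qed.

Lemma smooth_det k (A : M -> 'M[R]_k) : smooth_mx A ->
  smooth_fun_on U (fun p => \det (A p)).
Proof.
move=> HA; rewrite /determinant.
apply: (@smooth_fun_on_sum _ _ (fun (s : 'S_k) p =>
  (-1) ^+ s * \prod_i A p i (s i))) => s.
apply: smooth_fun_on_mul; first exact: smooth_fun_on_cst.
by apply: (@smooth_fun_on_prod _ _ (fun i p => A p i (s i))) => i; exact: HA.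
Qed.

(** By Cramer's formula the entries are cofactors divided by the determinant. *)
Lemma smooth_invmx k (A : M -> 'M[R]_k) :
  (forall p, U p -> A p \in unitmx) -> smooth_mx A ->
  smooth_mx (fun p => invmx (A p)).
Proof.
move=> uA HA i j.
apply: (@eq_smooth_fun_on _ (fun p => (\det (A p))^-1 *
  ((-1) ^+ (j + i) * \det (row' j (col' i (A p)))))) => //.
  by move=> p /uA Au; rewrite /invmx Au !mxE.
apply: smooth_fun_on_mul.
  apply: smooth_fun_on_inv; last exact: smooth_det.
  by move=> p /uA; rewrite unitmxE unitfE.
apply: smooth_fun_on_mul; first exact: smooth_fun_on_cst.
apply: smooth_det => i' j'.
apply: (@eq_smooth_fun_on _ (fun p => A p (lift j i') (lift i j'))) => //.
by move=> p _; rewrite !mxE.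
Qed.
End Ops.

Definition comp_in c p (a : fibre R n) : 'rV[R]_(n + n) :=
  row_mx (vec_in c p a.1) (cov_in c p a.2).

Lemma comp_inD c p (a b : fibre R n) : comp_in c p (a + b) =
  comp_in c p a + comp_in c p b.
Proof. by rewrite /comp_in /= vec_inD cov_inD -add_row_mx. Qed.

Lemma comp_inZ c p k (a : fibre R n) : comp_in c p (k *: a) = k *: comp_in c p a.
Proof. by rewrite /comp_in /= vec_inZ cov_inZ -scale_row_mx. Qed.

Lemma comp_in0 c p : comp_in c p 0 = 0.
Proof. by rewrite -(scale0r 0) comp_inZ scale0r. Qed.

Lemma smooth_realP U a : smooth_real U a <->
  forall c, atlas c -> forall j, smooth_in c U (fun p => comp_in c p (a p) 0 j).
Proof.
have cE c : (forall j, smooth_in c U (fun p => comp_in c p (a p) 0 j)) <->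
    (forall j, smooth_in c U (fun p => vec_in c p (a p).1 0 j)) /\
    (forall j, smooth_in c U (fun p => cov_in c p (a p).2 0 j)).
  have E1 j : (fun p => comp_in c p (a p) 0 (lshift n j)) =
      (fun p => vec_in c p (a p).1 0 j) by apply/funext => p; rewrite row_mxEl.
  have E2 j : (fun p => comp_in c p (a p) 0 (rshift n j)) =
      (fun p => cov_in c p (a p).2 0 j) by apply/funext => p; rewrite row_mxEr.
  split=> [H|[H1 H2] j]; first by split=> j; [rewrite -E1|rewrite -E2]; exact: H.
  by case: (split_ordP j) => k ->; [rewrite E1|rewrite E2].
split=> [[H1 H2] c ac|H]; first by apply/cE; split; [exact: H1|exact: H2].
by split=> c /H/cE[].
Qed.

Lemma smooth_real_sub U V a : V `<=` U -> smooth_real U a -> smooth_real V a.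
Proof.
move=> VU /smooth_realP H; apply/smooth_realP => c ac j.
exact: smooth_in_sub VU (H c ac j).
Qed.

Lemma smooth_real_local U a :
  (forall p, U p -> exists V, V p /\ smooth_real V a) -> smooth_real U a.
Proof.
move=> H; apply/smooth_realP => c ac j; apply: smooth_in_local => p.
by move=> /H[V [Vp /smooth_realP/(_ c ac j) Hj]]; exists V.
Qed.

Lemma eq_smooth_real U a b : open U -> (forall p, U p -> a p = b p) ->
  smooth_real U a -> smooth_real U b.
Proof.
move=> Uo ab /smooth_realP H; apply/smooth_realP => c ac j.
by apply: eq_smooth_in (H c ac j) => // p /ab ->.
Qed.

Lemma smooth_real0 U : smooth_real U (fun=> 0).
Proof.
apply/smooth_realP => c ac j; under eq_fun do rewrite comp_in0 mxE.
exact: smooth_in_cst.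
Qed.

Lemma smooth_real_add U a b : open U -> smooth_real U a -> smooth_real U b ->
  smooth_real U (fun p => a p + b p).
Proof.
move=> Uo /smooth_realP Ha /smooth_realP Hb; apply/smooth_realP => c ac j.
under eq_fun do rewrite comp_inD mxE.
exact: (smooth_in_add Uo (Ha c ac j) (Hb c ac j)).
Qed.

Lemma smooth_real_scale U f a : open U -> smooth_fun_on U f -> smooth_real U a ->
  smooth_real U (fun p => f p *: a p).
Proof.
move=> Uo Hf /smooth_realP Ha; apply/smooth_realP => c ac j.
under eq_fun do rewrite comp_inZ mxE.
exact: (smooth_in_mul Uo (Hf c ac) (Ha c ac j)).
Qed.

Lemma smooth_real_sum U (I : Type) (r : seq I) (a : I -> M ->
  fibre R n) : open U ->
  (forall i, smooth_real U (a i)) -> smooth_real U (fun p => \sum_(i <- r) a i p).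
Proof.
move=> Uo H; elim: r => [|i r IH].
  apply: (eq_smooth_real Uo _ (smooth_real0 U)) => p _.
  by rewrite big_nil.
apply: (eq_smooth_real Uo _ (smooth_real_add Uo (H i) IH)) => p _.
by rewrite big_cons.
Qed.

(** Components in the fixed chart [c] are genuine smooth functions on [U], which matrix arguments
    can handle; the raw values of [a] refer at each point to another chart. *)
Lemma comp_in_smooth c U a j : atlas c -> open U -> U `<=` dom c ->
  smooth_real U a -> smooth_fun_on U (fun p => comp_in c p (a p) 0 j).
Proof.
by move=> ac Uo Uc /smooth_realP/(_ c ac j); exact: smooth_fun_on_chart.
Qed.

End Sections.

(** * Bump functions on the manifold and extension of local sections by zero *)

Section Bump.
Variables (R : realType) (n : nat) (M : manifold R n).
Implicit Types (p q : M) (U V W : set M).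

Lemma continuous_coord_nbhs (c : chart R n M) p (A : set 'rV[R]_n) :
  dom c p -> nbhs (coord c p) A -> \forall q \near p, dom c q /\ A (coord c q).
Proof.
move=> cp nA.
have n1 : \forall q \near p, dom c q.
  by apply: open_nbhs_nbhs; split=> //; exact: open_dom.
have n2 : \forall q \near p, A (coord c q) by apply: (coord_continuous cp).
by apply: filterS2 n1 n2.
Qed.

Lemma bump U p : open U -> U p -> exists (f : M -> R) V W,
  [/\ smooth_fun_on setT f,
      [/\ open V, V p, V `<=` U & forall q, V q -> f q = 1] &
      [/\ open W, forall q, U q \/ W q & forall q, W q -> f q = 0]].
Proof.
move=> Uo Up; set c := chart_at p; have cp : dom c p by exact: mem_chart_at.
have ac : atlas c by exact: chart_at_atlas.
set x0 := coord c p; set A := coord c @` (U `&` dom c).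
have : nbhs x0 A.
  by apply: open_nbhs_nbhs; split; [exact: open_imcoord|exists p].
move=> /nbhs_ballP[r /= r0 rA]; pose s := r / 2.
have s0 : 0 < s by rewrite divr_gt0.
pose B := [set x : 'rV[R]_n | `|x0 - x| <= s].
have BA : B `<=` A.
  move=> x xs; apply: rA; rewrite -ball_normE /=; apply: le_lt_trans xs _.
  by rewrite ltr_pdivrMr // mulr_natr mulr2n ltrDr.
have Bc : compact B.
  have <- : closed_ball x0 s = B by rewrite closed_ballE.
  apply: bounded_closed_compact; last exact: closed_ball_closed.
  rewrite closed_ballE //; exists (`|x0| + s); split; first exact: num_real.
  move=> y ys x xs; apply: le_trans (ltW ys).
  by rewrite -lerBlDl; apply: le_trans (lerB_dist _ _) _; rewrite distrC.
pose K := icoord c @` B.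
have Kc : closed K.
  apply: compact_closed; first exact: manifold_hausdorff.
  apply: continuous_compact Bc; apply: continuous_in_subspaceT => x.
  rewrite inE => /BA/imcoordP[cx _]; exact: icoord_continuous.
have KU : K `<=` U `&` dom c.
  by move=> _ [x /BA/imcoordP[cx Ux] <-]; split=> //; exact: icoord_dom.
have [f [fs f0 f1]] := cutoff x0 s0.
pose g q : R := if `[< dom c q >] then f (coord c q) else 0.
have gE q : dom c q -> g q = f (coord c q) by move=> cq; rewrite /g asboolT.
have g0 q : (~` K) q -> g q = 0.
  move=> Kq; rewrite /g; case: asboolP => // cq; apply: f0; rewrite leNgt.
  by apply/negP => /ltW qs; apply: Kq; exists (coord c q); rewrite ?coordK.
have n1 := continuous_coord_nbhs cp f1.
exists g, (U `&` [set q | dom c q /\ f (coord c q) = 1])^°, (~` K); split.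
- apply: smooth_fun_on_local => q _; have [cq|cq] := pselect (dom c q).
    exists (dom c); split=> //; apply: (smooth_fun_on_chart ac) => //.
      exact: open_dom.
    apply: (eq_smooth_on (f := f)).
    + exact: open_imcoord (open_dom c).
    + by move=> x /imcoordP[cx dx]; rewrite gE // icoordK.
    + exact: smooth_on_sub fs.
  exists (~` K); split; first by move=> /KU[].
  apply: (eq_smooth_fun_on (f := fun=> 0)).
  + exact: closed_openC.
  + by move=> q' /g0.
  + exact: smooth_fun_on_cst.
- split; first exact: open_interior.
  + apply: filterI n1; exact: open_nbhs_nbhs.
  + by move=> q /interior_subset[].
  + by move=> q /interior_subset[_ [cq <-]]; rewrite gE.
- split=> //; first exact: closed_openC.
  by move=> q; have [/KU[]|] := pselect (K q); [left|right].
Qed.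

Lemma smooth_real_cutoff U W (f : M -> R) (a : M -> fibre R n) :
  open U -> open W -> (forall q, U q \/ W q) -> (forall q, W q -> f q = 0) ->
  smooth_fun_on setT f -> smooth_real U a ->
    smooth_real setT (fun q => f q *: a q).
Proof.
move=> Uo Wo UW f0 fs as_; apply: smooth_real_local => q _.
case: (UW q) => Hq; [exists U|exists W]; split=> //.
  by apply: smooth_real_scale => //; exact: smooth_fun_on_sub fs.
apply: (eq_smooth_real Wo _ (smooth_real0 _)) => q' /f0 ->.
by rewrite scale0r.
Qed.

End Bump.

(** * Linear algebra in the fibres *)

Section PairingTheory.
Variables (K : fieldType) (n : nat).
Implicit Types (a b : fibre K n) (S : set (fibre K n)).

Lemma evDl (x y v : 'rV[K]_n) : ev (x + y) v = ev x v + ev y v.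
Proof. by rewrite !evE mulmxDl mxE. Qed.
Lemma evDr (x v w : 'rV[K]_n) : ev x (v + w) = ev x v + ev x w.
Proof. by rewrite !evE linearD mulmxDr mxE. Qed.
Lemma evZl k (x v : 'rV[K]_n) : ev (k *: x) v = k * ev x v.
Proof. by rewrite !evE -scalemxAl mxE. Qed.
Lemma evZr k (x v : 'rV[K]_n) : ev x (k *: v) = k * ev x v.
Proof. by rewrite !evE linearZ -scalemxAr mxE. Qed.
Lemma evC (x v : 'rV[K]_n) : ev x v = ev v x.
Proof. by apply: eq_bigr => i _; rewrite mulrC. Qed.
Lemma ev0l (v : 'rV[K]_n) : ev 0 v = 0.
Proof. by rewrite -(scale0r 0) evZl mul0r. Qed.
Lemma ev0r (v : 'rV[K]_n) : ev v 0 = 0.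
Proof. by rewrite evC ev0l. Qed.
Lemma evNl (x v : 'rV[K]_n) : ev (- x) v = - ev x v.
Proof. by rewrite -scaleN1r evZl mulN1r. Qed.
Lemma pairingC a b : pairing a b = pairing b a.
Proof. by rewrite /pairing addrC. Qed.
Lemma pairingDl a a' b : pairing (a + a') b = pairing a b + pairing a' b.
Proof. by rewrite /pairing /= evDl evDr -mulrDr addrACA. Qed.
Lemma pairingZl k a b : pairing (k *: a) b = k * pairing a b.
Proof. by rewrite /pairing /= evZl evZr -mulrDr mulrCA. Qed.
Lemma pairingDr a b b' : pairing a (b + b') = pairing a b + pairing a b'.
Proof. by rewrite !(pairingC a) pairingDl. Qed.
Lemma pairingZr k a b : pairing a (k *: b) = k * pairing a b.
Proof. by rewrite !(pairingC a) pairingZl. Qed.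
Lemma pairingNl a b : pairing (- a) b = - pairing a b.
Proof. by rewrite -scaleN1r pairingZl mulN1r. Qed.
Lemma pairingNr a b : pairing a (- b) = - pairing a b.
Proof. by rewrite !(pairingC a) pairingNl. Qed.

Lemma fst_sumZ r (c : 'I_r -> K) (e : 'I_r -> fibre K n) :
  (\sum_i c i *: e i).1 = \sum_i c i *: (e i).1.
Proof. by apply: (big_morph (fun a : fibre K n => a.1)). Qed.
Lemma snd_sumZ r (c : 'I_r -> K) (e : 'I_r -> fibre K n) :
  (\sum_i c i *: e i).2 = \sum_i c i *: (e i).2.
Proof. by apply: (big_morph (fun a : fibre K n => a.2)). Qed.

Lemma orthP S k a b : orth S a -> orth S b -> orth S (k *: a + b).
Proof. by move=> Ha Hb c Sc; rewrite pairingDl pairingZl Ha // Hb // mulr0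
  addr0. Qed.

Lemma orth0 S : orth S 0.
Proof. by move=> c _; rewrite -(scale0r 0) pairingZl mul0r. Qed.
End PairingTheory.

Section LinearSets.
Variables (K : fieldType) (V : vectType K).

(** A vector subspace of maximal dimension among those contained in [S] is all of [S]: a missed
    vector would span a larger one together with it. *)
Lemma linear_set_vspace (S : set V) : S 0 ->
  (forall k a b, S a -> S b -> S (k *: a + b)) ->
  exists W : {vspace V}, S = [set v | v \in W].
Proof.
move=> S0 SL.
pose P d := `[< exists W : {vspace V}, \dim W = d /\ forall v, v \in W -> S v >].
have P0 : exists d, P d.
  exists 0%N; apply/asboolP; exists 0%VS; split; first by rewrite dimv0.
  by move=> v; rewrite memv0 => /eqP ->.
have Pb d : P d -> (d <= \dim {:V})%N.
  by move=> /asboolP[W [<- _]]; rewrite dimvS // subvf.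
have [d /asboolP[W [dW WS]] dmax] := ex_maxnP P0 Pb.
exists W; apply/seteqP; split=> v /=; last by move=> /WS.
move=> Sv; apply: contrapT => /negP vW.
have : P (\dim (<[v]> + W)%VS).
  apply/asboolP; exists (<[v]> + W)%VS; split=> //.
  by move=> _ /memv_addP[_ /vlineP[k ->] [w /WS Sw ->]]; exact: SL.
move=> /dmax; rewrite leqNgt => /negP; apply; rewrite -dW ltn_neqAle.
rewrite dimvS ?addvSr // andbT eqn_leq; apply/negP => /andP[_ le].
have : (W == <[v]> + W)%VS by rewrite eqEdim addvSr.
by move=> /eqP E; move: vW; rewrite E memvE addvSl.
Qed.

Lemma span_familyP r (e : 'I_r -> V) a :
  a \in <<[tuple e i | i < r]>>%VS <-> exists c : 'I_r ->
    K, a = \sum_i c i *: e i.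
Proof.
split=> [/coord_span aE|[c ->]].
  by exists (fun i => vector.coord [tuple e i | i < r] i a); rewrite {1}aE;
    apply: eq_bigr => i _;
     rewrite -tnth_nth tnth_mktuple.
by apply: memv_suml => i _; apply: memvZ; apply: memv_span; apply/mapP; exists i;
  rewrite ?mem_enum.
Qed.

Lemma free_familyP r (e : 'I_r -> V) :
  free [tuple e i | i < r] <-> forall c : 'I_r -> K, \sum_i c i *: e i = 0 ->
    forall i, c i = 0.
Proof.
have E c : \sum_i c i *: e i = \sum_(i < r) c i *: [tuple e i | i < r]`_i.
  by apply: eq_bigr => i _; rewrite -tnth_nth tnth_mktuple.
split=> [/freeP H c|H]; first by rewrite E => /H.
by apply/freeP => c; rewrite -E => /H.
Qed.

End LinearSets.

(** * Dimension of a lagrangian subspace, and extension of partially defined functionals *)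

Section LagrangianDimension.
Variables (K : fieldType) (n : nat).
Implicit Types (a b : fibre K n) (W : {vspace fibre K n}).

Definition fib_row a : 'rV[K]_(n + n) := row_mx a.1 a.2.

Lemma fib_rowD a b : fib_row (a + b) = fib_row a + fib_row b.
Proof. by rewrite /fib_row -add_row_mx. Qed.

Lemma fib_rowZ k a : fib_row (k *: a) = k *: fib_row a.
Proof. by rewrite /fib_row -scale_row_mx. Qed.

Lemma fib_row0 : fib_row 0 = 0.
Proof. by rewrite /fib_row row_mx0. Qed.

Lemma fib_row_sum r (c : 'I_r -> K) (e : 'I_r -> fibre K n) :
  fib_row (\sum_i c i *: e i) = (\row_i c i) *m \matrix_i fib_row (e i).
Proof.
rewrite mulmx_sum_row (big_morph fib_row fib_rowD fib_row0).
by apply: eq_bigr => i _; rewrite fib_rowZ rowK mxE.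
Qed.

Lemma fib_row_inj : injective fib_row.
Proof. by move=> [a1 a2] [b1 b2] /eq_row_mx[/= -> ->]. Qed.

Lemma pairing_row a b : 2%:R != 0 :> K ->
  (pairing a b = 0) <-> fib_row (a.2, a.1) *m (fib_row b)^T = 0.
Proof.
move=> two; rewrite /fib_row tr_row_mx mul_row_col /pairing /= !evE -(trmxK
  a.1) -(trmxK b.1).
have -> : (b.2 *m (a.1^T^T)^T) 0 0 = (a.1 *m b.2^T) 0 0.
  by rewrite trmxK -!evE evC.
rewrite !trmxK; split=> [/eqP|H].
  rewrite mulf_eq0 invr_eq0 (negPf two) /= => /eqP H.
  by apply/matrixP => i j; rewrite !ord1 [LHS]mxE addrC H mxE.
have -> : (a.1 *m b.2^T) 0 0 + (a.2 *m b.1^T) 0 0 =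
  (a.2 *m b.1^T + a.1 *m b.2^T) 0 0.
  by rewrite [RHS]mxE addrC.
by rewrite H mxE mulr0.
Qed.

(* A lagrangian subspace is the kernel of the map to its dual given by the
   pairing, hence has half of the dimension. *)
Lemma lagrangian_dim W : 2%:R != 0 :> K ->
  [set a | a \in W] = orth [set a | a \in W] -> \dim W = n.
Proof.
move=> two lagW; set r := \dim W; pose b (i : 'I_r) := (vbasis W)`_i.
have WE a : a \in W <-> exists c : 'I_r -> K, a = \sum_i c i *: b i.
  split=> [/coord_vbasis aE|[c ->]]; first by exists (fun i =>
    vector.coord (vbasis W) i a).
  by apply: memv_suml => i _; apply: memvZ;
    rewrite vbasis_mem // mem_nth // size_tuple.
pose A := \matrix_i fib_row (b i); pose A' := \matrix_i fib_row ((b i).2,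
  (b i).1).
have freeA : row_free A.
  rewrite -kermx_eq0; apply/rowV0P => v /sub_kermxP vA.
  have : \sum_i v 0 i *: b i = 0.
    apply: fib_row_inj; rewrite fib_row_sum fib_row0.
    rewrite (_ : \row_i v 0 i = v); last by apply/rowP => i; rewrite mxE.
    by rewrite -/A vA.
  move=> v0; apply/rowP => i; rewrite mxE.
  by have /freeP/(_ (fun j => v 0 j) v0) := basis_free (vbasisP W).
have swap (u : 'rV[K]_(n + n)) : exists a : fibre K n, u = fib_row a.
  by exists (lsubmx u, rsubmx u); rewrite /fib_row /= hsubmxK.
have memA a : (a \in W) = (fib_row a <= A)%MS.
  apply/idP/idP => [/WE[c ->]|/submxP[D aD]].
    by rewrite fib_row_sum submxMl.
  apply/WE; exists (fun i => D 0 i); apply: fib_row_inj;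
    rewrite fib_row_sum aD; congr (_ *m _).
  by apply/rowP => i; rewrite mxE.
have kerA a : (a \in W) = (fib_row a <= kermx A'^T)%MS.
  have mulE (i : 'I_r) : (fib_row a *m A'^T) 0 i = (fib_row ((b i).2,
    (b i).1) *m (fib_row a)^T) 0 0.
    rewrite !mxE; apply: eq_bigr => j _; rewrite !mxE mulrC; congr (_ * _).
  apply/idP/sub_kermxP => [aW|aA].
    have : [set a | a \in W] a by [].
    rewrite lagW => aO; apply/rowP => i; rewrite mulE [RHS]mxE.
    have : pairing (b i) a = 0.
      by rewrite pairingC; apply: aO; rewrite /= /b vbasis_mem // mem_nth //
        size_tuple.
    by move=> /pairing_row -> //; rewrite mxE.
  have : orth [set a | a \in W] a; last by rewrite -lagW.
  move=> _ /= /WE[c ->].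
  rewrite (big_morph (pairing a) (pairingDr a) (_ : _ = 0)); last first.
    by rewrite -(scale0r 0) pairingZr mul0r.
  apply: big1 => i _; rewrite pairingZr pairingC; apply/eqP; rewrite mulf_eq0;
    apply/orP; right.
  by apply/eqP/pairing_row => //; apply/rowP => j; rewrite !ord1 -mulE aA !mxE.
have eqA : (A :=: kermx A'^T)%MS.
  apply/eqmxP/andP; split; apply/rV_subP => v; have [a ->] := swap v.
    by rewrite -memA kerA.
  by rewrite -kerA memA.
have rA : \rank A = r by exact/eqP.
(* [Q] exchanges the tangent and cotangent halves; it turns [A] into [A'] and back, so the two have
   the same rank. *)
pose Q : 'M[K]_(n + n) := block_mx 0 1%:M 1%:M 0.
have rowQ a : fib_row a *m Q = fib_row (a.2, a.1).
  by rewrite /fib_row mul_row_block !mulmx0 !mulmx1 addr0 add0r.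
have rA' : \rank A' = r.
  have E1 : A' = A *m Q by apply/row_matrixP => i; rewrite row_mul !rowK rowQ.
  have E2 : A = A' *m Q.
    by apply/row_matrixP => i; rewrite row_mul !rowK rowQ; case: (b i).
  apply: etrans _ rA; apply/eqP; rewrite eqn_leq.
  have := mxrankM_maxl A Q; have := mxrankM_maxl A' Q.
  by rewrite -E1 -E2 => -> ->.
have := mxrank_ker A'^T; rewrite -eqA rA mxrank_tr rA' => E.
have := rank_leq_col A; rewrite rA => le.
by apply: double_inj; rewrite -!addnn {1}E subnK.
Qed.

End LagrangianDimension.

(** A linear relation that is single-valued at 0 is a functional on a subspace, and this extends to
    the whole space. In matrices, with [A] and [phi] collecting the two components of a basis of
    [T], each combination of rows killing [A] kills [phi], so [phi] is in the row space of [A^T]. *)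
Lemma functional_factor (K : fieldType) n (T : set ('rV[K]_n * K^o)%type) :
  T 0 -> (forall k s t, T s -> T t -> T (k *: s + t)) ->
  (forall t, T (0, t) -> t = 0) ->
  exists rho, forall y t, T (y, t) -> t = ev rho y.
Proof.
move=> T0 TL Tf; have [W TW] := linear_set_vspace T0 TL.
pose b (i : 'I_(\dim W)) := (vbasis W)`_i.
pose A : 'M[K]_(\dim W, n) := \matrix_i (b i).1.
pose phi : 'rV[K]_(\dim W) := \row_i (b i).2.
have TE (s : 'rV[K]_n * K^o) : T s <-> exists c : 'I_(\dim W) ->
  K, s = \sum_i c i *: b i.
  rewrite TW; split=> [/coord_vbasis sE|[c ->]].
    by exists (fun i => vector.coord (vbasis W) i s).
  by apply: memv_suml => i _; apply: memvZ;
    rewrite vbasis_mem // mem_nth // size_tuple.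
have comb (c : 'I_(\dim W) -> K) :
    \sum_i c i *: b i = (\row_i c i *m A, ((\row_i c i) *m phi^T) 0 0).
  rewrite mulmx_sum_row mxE [LHS]surjective_pairing.
  have -> : (\sum_i c i *: b i).1 = \sum_i c i *: (b i).1.
    by apply: (big_morph (fun s : 'rV[K]_n * K^o => s.1)).
  have -> : (\sum_i c i *: b i).2 = \sum_i c i *: (b i).2.
    by apply: (big_morph (fun s : 'rV[K]_n * K^o => s.2)).
  by congr (_, _); apply: eq_bigr => i _; rewrite ?rowK !mxE.
(* The columns of the cokernel of [A^T], transposed, are the coefficient rows [c] with [c *m A = 0];
   on these the hypothesis [Tf] applies. *)
have : (phi <= A^T)%MS.
  rewrite submxE -trmx_eq0 trmx_mul; apply/eqP/row_matrixP => i.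
  rewrite row0 row_mul; set c := row i _.
  have cA : c *m A = 0.
    rewrite /c -row_mul (_ : _ *m A = 0) ?row0 //.
    by apply: trmx_inj; rewrite trmx_mul trmxK mulmx_coker trmx0.
  have cE : \row_j c 0 j = c by apply/rowP => j; rewrite mxE.
  have := comb (fun j => c 0 j); rewrite cE cA => E.
  apply/rowP => j; rewrite !ord1 [RHS]mxE; apply: Tf.
  by apply/TE; exists (fun j => c 0 j); rewrite E.
move=> /submxP[rho rhoE]; exists rho => y t /TE[c]; rewrite comb => -[-> ->].
by rewrite evC evE rhoE trmx_mul trmxK mulmxA.
Qed.

(** * Real and imaginary parts in the complexified fibres *)

Section ComplexFibres.
Variables (R : realType) (n : nat).
Local Notation C := R[i].
Implicit Types (a b l m : fibre C n) (u v : fibre R n) (z w : C).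

Lemma ReD z w : complex.Re (z + w) = complex.Re z + complex.Re w.
Proof. by case: z; case: w. Qed.
Lemma ImD z w : complex.Im (z + w) = complex.Im z + complex.Im w.
Proof. by case: z; case: w. Qed.
Lemma ReM z w : complex.Re (z * w) =
  complex.Re z * complex.Re w - complex.Im z * complex.Im w.
Proof. by case: z; case: w. Qed.
Lemma ImM z w : complex.Im (z * w) =
  complex.Re z * complex.Im w + complex.Im z * complex.Re w.
Proof. by case: z; case: w. Qed.
Lemma complex_ext z w : complex.Re z = complex.Re w ->
  complex.Im z = complex.Im w -> z = w.
Proof. by case: z => ? ?; case: w => ? ? /= -> ->. Qed.

Lemma re_fibD a b : re_fib (a + b) = re_fib a + re_fib b.
Proof. by congr (_, _); apply/rowP => i; rewrite !mxE ReD. Qed.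
Lemma im_fibD a b : im_fib (a + b) = im_fib a + im_fib b.
Proof. by congr (_, _); apply/rowP => i; rewrite !mxE ImD. Qed.
Lemma re_fibZ z a : re_fib (z *: a) = complex.Re z *: re_fib a - complex.Im z
  *: im_fib a.
Proof. by congr (_, _); apply/rowP => i; rewrite !mxE ReM. Qed.
Lemma im_fibZ z a : im_fib (z *: a) = complex.Re z *: im_fib a + complex.Im z
  *: re_fib a.
Proof. by congr (_, _); apply/rowP => i; rewrite !mxE ImM. Qed.
Lemma fib_ext a b : re_fib a = re_fib b -> im_fib a = im_fib b -> a = b.
Proof.
case: a b => [a1 a2] [b1 b2] [/rowP r1 /rowP r2] [/rowP i1 /rowP i2].
by congr (_, _); apply/rowP => i; apply: complex_ext;
  [have := r1 i|have := i1 i|have := r2 i|have := i2 i]; rewrite !mxE.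
Qed.
Lemma re_fib0 : re_fib (0 : fibre C n) = 0.
Proof. by congr (_, _); apply/rowP => i; rewrite !mxE. Qed.
Lemma im_fib0 : im_fib (0 : fibre C n) = 0.
Proof. by congr (_, _); apply/rowP => i; rewrite !mxE. Qed.
Lemma re_cfib u : re_fib (cfib u) = u.
Proof. by case: u => u1 u2; congr (_, _); apply/rowP => i; rewrite !mxE. Qed.
Lemma im_cfib u : im_fib (cfib u) = 0.
Proof. by congr (_, _); apply/rowP => i; rewrite !mxE. Qed.

Definition mk_fib u v : fibre C n := cfib u + 'i%C *: cfib v.

Lemma re_mk u v : re_fib (mk_fib u v) = u.
Proof. by rewrite re_fibD re_fibZ !re_cfib im_cfib /= scale0r scaler0 subr0
  addr0. Qed.
Lemma im_mk u v : im_fib (mk_fib u v) = v.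
Proof. by rewrite im_fibD im_fibZ !re_cfib !im_cfib /= scale1r scale0r !add0r.
  Qed.
Lemma re_fib_sum r (z : 'I_r -> C) (e : 'I_r -> fibre C n) :
  re_fib (\sum_i z i *: e i) =
  \sum_i (complex.Re (z i) *: re_fib (e i) - complex.Im (z i) *: im_fib (e i)).
Proof.
rewrite (big_morph _ re_fibD re_fib0).
by apply: eq_bigr => i _; rewrite re_fibZ.
Qed.
Lemma im_fib_sum r (z : 'I_r -> C) (e : 'I_r -> fibre C n) :
  im_fib (\sum_i z i *: e i) =
  \sum_i (complex.Re (z i) *: im_fib (e i) + complex.Im (z i) *: re_fib (e i)).
Proof.
rewrite (big_morph _ im_fibD im_fib0).
by apply: eq_bigr => i _; rewrite im_fibZ.
Qed.

Lemma Re_ev (x y : 'rV[C]_n) : complex.Re (ev x y) =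
  ev (re_vec x) (re_vec y) - ev (im_vec x) (im_vec y).
Proof.
rewrite /ev (big_morph _ ReD (_ : complex.Re 0 = 0)) // -sumrB.
by apply: eq_bigr => i _; rewrite !mxE ReM.
Qed.
Lemma Im_ev (x y : 'rV[C]_n) : complex.Im (ev x y) =
  ev (re_vec x) (im_vec y) + ev (im_vec x) (re_vec y).
Proof.
rewrite /ev (big_morph _ ImD (_ : complex.Im 0 = 0)) // -big_split.
by apply: eq_bigr => i _; rewrite !mxE ImM.
Qed.

Lemma Re_half z : complex.Re (2%:R^-1 * z) = 2%:R^-1 * complex.Re z.
Proof.
suff -> : (2%:R^-1 : C) = (2%:R^-1 : R)%:C%C by rewrite ReM /= mul0r subr0.
by rewrite fmorphV rmorph_nat.
Qed.
Lemma Im_half z : complex.Im (2%:R^-1 * z) = 2%:R^-1 * complex.Im z.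
Proof.
suff -> : (2%:R^-1 : C) = (2%:R^-1 : R)%:C%C by rewrite ImM /= mul0r addr0.
by rewrite fmorphV rmorph_nat.
Qed.

Lemma Re_pairing a b : complex.Re (pairing a b) =
  pairing (re_fib a) (re_fib b) - pairing (im_fib a) (im_fib b).
Proof. by rewrite /pairing Re_half ReD !Re_ev -mulrBr /=; congr (_ * _);
  ring. Qed.
Lemma Im_pairing a b : complex.Im (pairing a b) =
  pairing (re_fib a) (im_fib b) + pairing (im_fib a) (re_fib b).
Proof. by rewrite /pairing Im_half ImD !Im_ev -mulrDr /=; congr (_ * _);
  ring. Qed.

End ComplexFibres.

(** * The distribution L(Delta, omega_Delta) at a single point *)

Section Hat.
Variables (R : realType) (n : nat).
Local Notation C := R[i].
Implicit Types (S : set (fibre C n)) (a b l m : fibre C n) (u v : fibre R n).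

Lemma two_neq0 (F : numFieldType) : 2%:R != 0 :> F.
Proof. by rewrite pnatr_eq0. Qed.

(* For S = L p this is L(Delta, omega_Delta) at p, see [hat_LE]. *)
Definition hat S : set (fibre R n) :=
  [set u | exists l, [/\ S l, (im_fib l).1 = 0 & u = ((re_fib l).1,
    (im_fib l).2)]].

Lemma lagr0 S : S = orth S -> S 0.
Proof. by move=> ->; exact: orth0. Qed.

Lemma lagr_lin S k a b : S = orth S -> S a -> S b -> S (k *: a + b).
Proof. by move=> SS Sa Sb; rewrite SS; apply: orthP; rewrite -SS. Qed.

Lemma lagrZ S k a : S = orth S -> S a -> S (k *: a).
Proof.
by move=> SS Sa; rewrite -[_ *: _]addr0; apply: lagr_lin => //; exact: lagr0.
Qed.

Lemma lagrD S a b : S = orth S -> S a -> S b -> S (a + b).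
Proof. by move=> SS Sa Sb; rewrite -[a]scale1r; exact: lagr_lin. Qed.

Lemma lagr_sum S r (z : 'I_r -> C) (e : 'I_r -> fibre C n) : S = orth S ->
  (forall i, S (e i)) -> S (\sum_i z i *: e i).
Proof.
move=> SS Se; apply: big_ind => [|a b|i _]; first exact: lagr0.
  exact: lagrD.
exact: lagrZ.
Qed.

Lemma re_iZ a : re_fib ('i%C *: a) = - im_fib a.
Proof. by rewrite re_fibZ /= scale0r scale1r add0r. Qed.
Lemma im_iZ a : im_fib ('i%C *: a) = re_fib a.
Proof. by rewrite im_fibZ /= scale0r scale1r add0r. Qed.

Lemma re_niZ a : re_fib (- 'i%C *: a) = im_fib a.
Proof. by rewrite re_fibZ /= oppr0 scale0r scaleN1r add0r opprK. Qed.
Lemma im_niZ a : im_fib (- 'i%C *: a) = - re_fib a.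
Proof. by rewrite im_fibZ /= oppr0 scale0r scaleN1r add0r. Qed.

Lemma half_eq0 (x : R) : 2%:R^-1 * x = 0 -> x = 0.
Proof. by move/eqP; rewrite mulf_eq0 invr_eq0 (negPf (two_neq0 R)) => /eqP. Qed.

(** For lifts with real vector part, the imaginary part of their complex pairing is the real pairing
    of [u] and [v]. *)
Lemma hat_isotropic S u v : S = orth S -> hat S u -> hat S v -> pairing u v = 0.
Proof.
move=> SS [l [Sl l1 ->]] [m [Sm m1 ->]].
have lm : pairing l m = 0 by move: Sl; rewrite SS => /(_ _ Sm).
have := Im_pairing l m; rewrite lm /= /pairing l1 m1 !ev0r add0r addr0 -mulrDr
  => /esym.
by rewrite addrC => E; rewrite /= -[RHS]E addrC.
Qed.

(** For [(X, xi)] orthogonal to [hat S], a covector [rho] is sought such that X + rho + i xi is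
    orthogonal to [S], hence lies in [S]. *)
Lemma hat_lagrangian S : S = orth S -> hat S = orth (hat S).
Proof.
move=> SS; apply/seteqP; split=> [u Hu v|[X xi] H]; first exact: hat_isotropic.
(* The value that [rho] must take on the real vector part of [l] for the real part of the pairing
   with [l] to vanish. *)
pose t l : R := ev xi (im_fib l).1 - ev (re_fib l).2 X.
pose T : set ('rV[R]_n * R^o) := [set s | exists l, S l /\ s = ((re_fib l).1,
  t l)].
have [||x|rho rhoE] := @functional_factor R n T.
- exists 0; split; first exact: lagr0.
  by rewrite /t re_fib0 im_fib0 /= ev0r ev0l subr0.
- move=> k _ _ [l [Sl ->]] [m [Sm ->]]; exists (k%:C%C *: l + m); split.
    exact: lagr_lin.
  rewrite /t re_fibD im_fibD re_fibZ im_fibZ /= !scale0r subr0 addr0.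
  congr (_, _); rewrite /= !(evDl, evDr, evZl, evZr) oppr0 ev0l addr0.
  rewrite -[LHS]/(k * (ev xi (im_vec l.1) - ev (re_vec l.2) X) +
    (ev xi (im_vec m.1) - ev (re_vec m.2) X)).
  ring.
- move=> [l [Sl [l1 ->]]].
  (* The vector part of [l] is purely imaginary here, so that of [- 'i%C *: l] is real; it gives an
     element of [hat S], and orthogonality to it says [t l = 0]. *)
  have Sil : S (- 'i%C *: l) by exact: lagrZ.
  have : hat S ((im_fib l).1, - (re_fib l).2).
    exists (- 'i%C *: l); split=> //; first by rewrite im_niZ /= -l1 oppr0.
    by rewrite re_niZ im_niZ.
  move=> /H/half_eq0 /=; rewrite evNl => E.
  by rewrite /t -E addrC.
pose m := mk_fib (X, rho) (0, xi).
have Re0 l : S l -> complex.Re (pairing m l) = 0.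
  move=> Sl; rewrite Re_pairing /m re_mk im_mk /pairing /= ev0r add0r.
  have : T ((re_fib l).1, t l) by exists l.
  move=> /rhoE E; rewrite -mulrBr -E /t; ring.
exists m; rewrite /m re_mk im_mk; split=> //; rewrite SS => l Sl.
apply: complex_ext; first exact: Re0.
(* The imaginary part vanishes by testing the real part on ['i%C *: l]. *)
have := Re0 _ (lagrZ 'i%C SS Sl); rewrite pairingZr ReM /= mul0r mul1r sub0r =>
  /eqP.
by rewrite oppr_eq0 => /eqP.
Qed.

Variable M : manifold R n.
Variable L : M -> set (fibre C n).
Hypothesis lagL : lagrangian L.

Lemma DeltaP p X : Delta L p X <-> exists zeta, L p (cvec X, zeta).
Proof.
split=> [[[[Y z] LX /= <-] _]|[z LX]]; first by exists z.
have EX : E_of L p (cvec X) by exists (cvec X, z).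
split=> //; exists (cvec X) => //.
by apply/rowP => i; rewrite !mxE conjc_real.
Qed.

Lemma real_vecE (l : fibre C n) : (im_fib l).1 = 0 ->
  l = (cvec (re_fib l).1, l.2).
Proof.
case: l => l1 l2 /= /rowP H; congr (_, _); apply/rowP => i.
by have := H i; rewrite !mxE; case: (l1 0 i) => ? ? /= ->.
Qed.

Lemma re_cvec (X : 'rV[R]_n) : re_vec (cvec X) = X.
Proof. by apply/rowP => i; rewrite !mxE. Qed.
Lemma im_cvec (X : 'rV[R]_n) : im_vec (cvec X) = 0.
Proof. by apply/rowP => i; rewrite !mxE. Qed.

Lemma omegaE p X zeta Y : L p (cvec X, zeta) -> Delta L p Y ->
  omega L p X Y = ev (im_vec zeta) Y.
Proof.
move=> LX /DeltaP[z LY]; rewrite /omega (epsE lagL LX);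
  last by exists (cvec Y, z).
by rewrite Im_ev re_cvec im_cvec ev0r add0r.
Qed.

(** The inclusion into [hat (L p)] builds no lift. By [omegaE], pairing an element of [hat_L L p]
    with one of [hat (L p)] gives the imaginary part of a pairing in [L p], which is zero, and
    [hat (L p)] contains its orthogonal. *)
Lemma hat_LE p : hat_L L p = hat (L p).
Proof.
have sub u : hat (L p) u -> hat_L L p u.
  move=> [l [Ll /real_vecE E ->]]; rewrite E in Ll.
  split; first by apply/DeltaP; exists l.2.
  by move=> Y HY; rewrite (omegaE Ll HY).
apply/seteqP; split=> [u [/DeltaP[z Lz] H]|]; last exact: sub.
rewrite (hat_lagrangian (lagL p)) => v Hv; have [l [Ll /real_vecE E ->]] := Hv.
rewrite E in Ll; have Dl : Delta L p (re_fib l).1 by apply/DeltaP; exists l.2.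
rewrite /pairing /= H // (omegaE Lz Dl).
have : pairing (cvec u.1, z) (cvec (re_fib l).1, l.2) = 0.
  by move: Lz; rewrite lagL => /(_ _ Ll).
move=> /(congr1 (@complex.Im R)); rewrite Im_pairing /pairing /=.
rewrite !re_cvec !im_cvec !ev0r add0r addr0 -mulrDr /= => H0.
by rewrite -[RHS]H0.
Qed.

(** This turns the order into the corank of the real linear map Im o pr_T on [L p]. A real Y plus
    conjugate of Z equals the real part of Y + Z, that is, the imaginary part of i(Y + Z). *)
Lemma D_ofE p : D_of L p = [set (im_fib l).1 | l in L p].
Proof.
apply/seteqP; split=> X /=.
  move=> [Y [l Ll <-] [_ [_ [m Lm <-] <-] E]].
  exists ('i%C *: (l + m)); first by apply: lagrZ => //; exact: lagrD.
  apply/rowP => i.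
  have := congr1 (fun v : 'rV[C]_n => complex.Re (v 0 i)) E.
  rewrite !mxE ReD ImM !ReD /= mul0r mul1r add0r => <-.
  by case: (m.1 0 i).
(* With this factor, [k] plus its conjugate is twice its real part, which is the imaginary part of
   [l]. *)
move=> [l Ll <-]; pose k := (- 'i%C * 2%:R^-1) *: l.
have Lk : L p k by exact: lagrZ.
exists k.1; first by exists k.
exists (conj_vec k.1); first by exists k.1 => //; exists k.
apply/rowP => i; rewrite !mxE -mulrA; set w := 2%:R^-1 * _.
have -> (z : C) : z + (z^*)%C = (2%:R * complex.Re z)%:C%C.
  by rewrite addcJ rmorphM rmorph_nat.
rewrite ReM /= oppr0 mul0r sub0r mulN1r opprK /w Im_half mulrA divff ?mul1r //.
Qed.

End Hat.

(** * Smooth local frames *)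

Section ConstantRank.
Variables (K : fieldType) (N n : nat).
Implicit Types (B : 'M[K]_(N, n)).

Lemma rank_rowspace B : rank [set v : 'rV[K]_n | (v <= B)%MS] = \rank B.
Proof.
have S0 : [set v : 'rV[K]_n | (v <= B)%MS] 0 by exact: sub0mx.
have SL (k : K) (a b : 'rV[K]_n) : [set v : 'rV[K]_n | (v <= B)%MS] a ->
    [set v : 'rV[K]_n | (v <= B)%MS] b -> [set v : 'rV[K]_n | (v <= B)%MS] (k
      *: a + b).
  by move=> /= aB bB; rewrite addmx_sub // scalemx_sub.
have [W WB] := linear_set_vspace S0 SL; rewrite WB rank_vspace.
have {}WB v : (v \in W) = (v <= B)%MS.
  by apply/idP/idP => H; [have : [set v | v \in W] v by [] | have : [set v :
    'rV[K]_n | (v <= B)%MS] v by []];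
     rewrite ?WB // -WB.
pose A : 'M[K]_(\dim W, n) := \matrix_i (vbasis W)`_i.
have AB : (A :=: B)%MS.
  apply/eqmxP/andP; split; last first.
    apply/rV_subP => v; rewrite -WB => /coord_vbasis ->.
    apply: summx_sub => i _; apply: scalemx_sub.
    by rewrite (_ : (vbasis W)`_i = row i A) ?row_sub // rowK.
  by apply/row_subP => i; rewrite rowK -WB vbasis_mem // mem_nth // size_tuple.
rewrite -AB; apply/esym/eqP; rewrite -/(row_free A) -kermx_eq0.
apply/rowV0P => v /sub_kermxP vA; have /freeP F := basis_free (vbasisP W).
apply/rowP => i; rewrite mxE; apply: (F (fun j => v 0 j)).
by rewrite -[RHS]vA mulmx_sum_row; apply: eq_bigr => j _; rewrite rowK.
Qed.

(** Taken at a base point and then kept fixed, [T] and [S] play the part of the choice of a nonzero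
    maximal minor: [T *m B q *m S] stays invertible for [q] nearby. *)
Lemma rank_inverses B : exists (T : 'M[K]_(\rank B, N)) (S : 'M[K]_(n, \rank B)),
  T *m B *m S = 1%:M.
Proof.
exists (pinvmx (col_base B)), (pinvmx (row_base B)).
rewrite -[X in _ *m X *m _](mulmx_base B) mulmxA mulVpmx ?col_base_full //.
by rewrite mul1mx mulmxVp // row_base_free.
Qed.

(* When [T B S] is invertible of size [\rank B], this is a projection of the
   space of rows onto the kernel of [B]. *)
Definition ker_proj d (T : 'M[K]_(d, N)) (S : 'M[K]_(n, d)) B : 'M[K]_N :=
  1%:M - B *m S *m invmx (T *m B *m S) *m T.

(** Invertibility gives [T *m B] rank at least [d], the rank of [B], so both have the same row space
    and [B = Z *m (T *m B)]; then the subtracted term times [B] is [B] itself. *)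
Lemma ker_projP d (T : 'M[K]_(d, N)) (S : 'M[K]_(n, d)) B :
  \rank B = d -> T *m B *m S \in unitmx -> ker_proj T S B *m B = 0.
Proof.
move=> rB u; have : (B <= T *m B)%MS.
  have := mxrank_leqif_sup (submxMl T B) => /leqifP.
  case: ifP => // _; rewrite rB ltnNge => /negP[].
  have := mxrankM_maxl (T *m B) S; rewrite mxrank_unit //.
move=> /submxP[Z BE]; rewrite /ker_proj mulmxBl mul1mx -!mulmxA.
rewrite [in X in _ - X](_ : B *m _ = Z *m (T *m B *m S) *m (invmx (T *m B *m S)
  *m (T *m B))).
  by rewrite -mulmxA [T *m B *m S *m _]mulmxA mulmxV // mul1mx -BE subrr.
by rewrite {1}BE !mulmxA.
Qed.

Lemma ker_proj_id d m (T : 'M[K]_(d, N)) (S : 'M[K]_(n, d)) B (c : 'M[K]_(m, N)) :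
  c *m B = 0 -> c *m ker_proj T S B = c.
Proof. by move=> cB; rewrite /ker_proj mulmxBr mulmx1 !mulmxA cB !mul0mx subr0.
  Qed.
End ConstantRank.

(** * Smooth coefficients of a section in an independent family *)

Section Coordinates.
Variables (R : realType) (n : nat) (M : manifold R n).
Implicit Types (p q : M) (U V : set M).

Lemma open_neq0 U (f : M -> R) : open U -> smooth_fun_on U f ->
  open (U `&` [set q | f q != 0]).
Proof.
move=> Uo Hf; rewrite openE => q [Uq /= fq].
have cq := mem_chart_at q; have ac := chart_at_atlas q.
have := Hf _ ac 0%N; set c := chart_at q => Hc.
have xq : (coord c @` (U `&` dom c)) (coord c q) by exists q.
have := Hc _ xq; rewrite /prop_for /continuous_at coordK // => cf.
have n1 : \forall x \near coord c q, f (icoord c x) != 0.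
  exact: cvgr_neq0 cf fq.
have n2 := continuous_coord_nbhs cq n1.
have n3 : \forall y \near q, U y by apply: open_nbhs_nbhs; split.
by apply: filterS2 n2 n3 => y [cy]; rewrite coordK.
Qed.

Lemma comp_in_sum c p m (l : 'I_m -> R) (f : 'I_m -> fibre R n) :
  comp_in c p (\sum_k l k *: f k) = (\row_k l k) *m \matrix_k comp_in c p (f k).
Proof.
rewrite mulmx_sum_row (big_morph _ (comp_inD c p) (comp_in0 c p)).
by apply: eq_bigr => k _; rewrite comp_inZ rowK mxE.
Qed.

Lemma comp_in_chart_at p (a : fibre R n) : comp_in (chart_at p) p a = fib_row a.
Proof. by rewrite /comp_in vec_in_chart_at cov_in_chart_at. Qed.

(** The family may be shorter than a frame, so its component matrix [F] is made square by a fixed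
    right inverse [S] of [F p]. Where [F q *m S] is invertible the family is independent, and
    coefficients are recovered by the smooth inverse. *)
Lemma smooth_coordinates m (f : 'I_m -> M -> fibre R n) U p :
  open U -> U p -> (forall k, smooth_real U (f k)) ->
  (forall l : 'I_m -> R, \sum_k l k *: f k p = 0 -> forall k, l k = 0) ->
  exists V, [/\ open V, V p, V `<=` U,
    forall q, V q -> forall l : 'I_m -> R,
      \sum_k l k *: f k q = 0 -> forall k, l k = 0 &
    forall V' a, open V' -> V' `<=` V -> smooth_real V' a ->
      (forall q, V' q -> exists l : 'I_m -> R, a q = \sum_k l k *: f k q) ->
      exists l : 'I_m -> M -> R, (forall k, smooth_fun_on V' (l k)) /\
        forall q, V' q -> a q = \sum_k l k q *: f k q].
Proof.
move=> Uo Up fs indep; set c := chart_at p.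
have cp : dom c p := mem_chart_at p; have ac : atlas c := chart_at_atlas p.
pose F q : 'M[R]_(m, n + n) := \matrix_k comp_in c q (f k q).
have rF : row_free (F p).
  rewrite -kermx_eq0; apply/rowV0P => v /sub_kermxP vF; apply/rowP => k;
    rewrite mxE.
  apply: (indep (fun k => v 0 k)); apply: fib_row_inj.
  rewrite fib_row0 -(comp_in_chart_at p) comp_in_sum -[RHS]vF; congr (_ *m _).
  by apply/rowP => j; rewrite mxE.
pose S := pinvmx (F p).
pose U1 := U `&` dom c; have U1o : open U1 by apply: openI => //; exact: open_dom.
have Fs : smooth_mx U1 F.
  move=> k j; apply: (eq_smooth_fun_on (f := fun q =>
    comp_in c q (f k q) 0 j)) => //.
    by move=> q _; rewrite [RHS]mxE.
  apply: comp_in_smooth => //; first by move=> ? [].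
  by apply: smooth_real_sub (fs k) => ? [].
have FSs : smooth_mx U1 (fun q => F q *m S).
  by apply: smooth_mx_mul => //; exact: smooth_mx_cst.
pose V := U1 `&` [set q | \det (F q *m S) != 0].
have Vo : open V by apply: open_neq0 => //; exact: smooth_det.
have VU q : V q -> F q *m S \in unitmx by move=> [_]; rewrite unitmxE unitfE.
have VK q (v : 'rV_m) : V q -> v *m F q *m S *m invmx (F q *m S) = v.
  by move=> /VU u; rewrite -(mulmxA v) mulmxK.
exists V; split=> //.
- by split=> //=; rewrite mulmxVp // det1 oner_neq0.
- by move=> q [[]].
- move=> q Vq l l0 k; have := VK q (\row_k l k) Vq.
  have := comp_in_sum c q l (fun k => f k q); rewrite l0 comp_in0 -/(F q) => <-.
  by rewrite !mul0mx => /rowP/(_ k); rewrite !mxE.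
move=> V' a V'o V'V as_ aspan.
pose l q : 'rV[R]_m := comp_in c q (a q) *m S *m invmx (F q *m S).
exists (fun k q => l q 0 k); split=> [k|q V'q].
  have : smooth_mx V' l; last by apply.
  apply: smooth_mx_mul => //; last first.
    apply: smooth_invmx => //; first by move=> q /V'V/VU.
    by move=> i j; apply: smooth_fun_on_sub (FSs i j) => q /V'V[].
  apply: smooth_mx_mul => //; last exact: smooth_mx_cst.
  move=> i j; rewrite (ord1 i); apply: comp_in_smooth => //.
  by move=> q /V'V[[]].
have [l' E] := aspan q V'q.
have -> : l q = \row_k l' k.
  by rewrite /l E comp_in_sum VK //; exact: V'V.
by rewrite E; apply: eq_bigr => k _; rewrite mxE.
Qed.
End Coordinates.

(** * Local lifts to L of a frame of L(Delta, omega_Delta) *)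

Section HatFrame.
Variables (R : realType) (n : nat) (M : manifold R n).
Local Notation C := R[i].
Implicit Types (p q : M) (U V : set M).
Variable L : M -> set (fibre C n).
Hypothesis sbL : smooth_subbundle (@smooth_complex R n M) L.
Hypothesis lagL : lagrangian L.

Lemma smooth_real_opp U (a : M -> fibre R n) : open U ->
  smooth_real U a -> smooth_real U (fun q => - a q).
Proof.
move=> Uo Ha; have := smooth_real_scale Uo (smooth_fun_on_cst U (-1)) Ha.
by apply: eq_smooth_real => // q _; rewrite scaleN1r.
Qed.

Lemma smooth_complex_i U (a : M -> fibre C n) : open U ->
  smooth_complex U a -> smooth_complex U (fun q => 'i%C *: a q).
Proof.
move=> Uo [H1 H2]; split.
  by apply: (eq_smooth_real Uo _ (smooth_real_opp Uo H2)) => q _; rewrite re_iZ.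
by apply: (eq_smooth_real Uo _ H1) => q _; rewrite im_iZ.
Qed.

Definition rcomb N (g : 'I_N -> fibre C n) (c : 'rV[R]_N) : fibre C n :=
  \sum_j (c 0 j)%:C%C *: g j.

Lemma re_rcomb N (g : 'I_N -> fibre C n) c :
  re_fib (rcomb g c) = \sum_j c 0 j *: re_fib (g j).
Proof. by rewrite re_fib_sum; apply: eq_bigr => j _;
  rewrite /= scale0r subr0. Qed.

Lemma im_rcomb N (g : 'I_N -> fibre C n) c :
  im_fib (rcomb g c) = \sum_j c 0 j *: im_fib (g j).
Proof. by rewrite im_fib_sum; apply: eq_bigr => j _;
  rewrite /= scale0r addr0. Qed.

(** A complex frame together with its multiples by i generates over the reals, so that Im o pr_T on
    L becomes a real matrix. *)
Lemma real_generators p : exists U, [/\ open U, U p &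
  exists N (g : 'I_N -> M -> fibre C n), (forall j, smooth_complex U (g j)) /\
    forall q, U q -> L q = [set rcomb (g^~ q) c | c in setT]].
Proof.
have [U [Uo [Up [r [e [es eL]]]]]] := sbL p.
exists U; split=> //; exists (r + r)%N.
pose g (j : 'I_(r + r)) q := match fintype.split j with inl i =>
  e i q | inr i => 'i%C *: e i q end.
exists g; split=> [j|q Uq].
  by rewrite /g; case: (fintype.split j) => i;
    [exact: es|exact: smooth_complex_i].
have [_ Le] := eL q Uq.
have eLq i : L q (e i q).
  by rewrite Le /=; apply: memv_span; apply/mapP; exists i; rewrite ?mem_enum.
apply/seteqP; split=> [l|_ [c _ <-]].
  rewrite Le /= => /span_familyP[z ->].
  exists (row_mx (\row_i complex.Re (z i)) (\row_i complex.Im (z i))) => //.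
  rewrite /rcomb big_split_ord /= -big_split /=; apply: eq_bigr => i _.
  rewrite /g (unsplitK (inl i)) (unsplitK (inr i)) row_mxEl row_mxEr !mxE.
  by rewrite scalerA -scalerDl mulrC -complexE.
apply: lagr_sum => // j; rewrite /g; case: (fintype.split j) => i //.
exact: lagrZ.
Qed.

(** The map from X + zeta to X + Im zeta, meaningful for real X; taken on all of L it is real
    linear, which lets it commute with [rcomb]. *)
Definition tau (l : fibre C n) : fibre R n := ((re_fib l).1, (im_fib l).2).

Lemma tau_smooth U a : open U -> smooth_complex U a ->
  smooth_real U (fun q => tau (a q)).
Proof. by move=> Uo [[H1 H2] [H3 H4]]; split. Qed.

Lemma tau_rcomb N (g : 'I_N -> fibre C n) c :
  tau (rcomb g c) = \sum_j c 0 j *: tau (g j).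
Proof.
by rewrite /tau re_rcomb im_rcomb [RHS]surjective_pairing !fst_sumZ !snd_sumZ.
Qed.

Lemma hat_vspace q : exists W : {vspace fibre R n},
  hat (L q) = [set u | u \in W] /\ \dim W = n.
Proof.
have H := hat_lagrangian (lagL q).
have [||W WE] := @linear_set_vspace _ _ (hat (L q)).
- by rewrite H; exact: orth0.
- by move=> k a b Ha Hb; rewrite H; apply: orthP; rewrite -H.
by exists W; split=> //; apply: lagrangian_dim; rewrite -?WE // two_neq0.
Qed.

Lemma hat_span q (f : 'I_n -> fibre R n) : (forall k, hat (L q) (f k)) ->
  (forall l : 'I_n -> R, \sum_k l k *: f k = 0 -> forall k, l k = 0) ->
  hat (L q) = [set u | u \in <<[tuple f k | k < n]>>%VS].
Proof.
move=> fH /free_familyP f_free; have [W [WE dW]] := hat_vspace q.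
rewrite WE (_ : W = <<[tuple f k | k < n]>>%VS) //; apply/eqP.
rewrite eq_sym eqEdim dW -[X in (X <= _)%N](size_tuple [tuple f k | k < n]).
have /eqP -> := f_free; rewrite leqnn andbT; apply/span_subvP => _ /mapP[k _ ->].
by have := fH k; rewrite WE.
Qed.

(** The lifts [h] are kept along with their images under [tau], because brackets are controlled only
    in [L]. Their number is [n]: independence at [p] persists nearby, and [hat_span] then gives
    spanning. *)
Lemma hat_frame p : (exists k, forall q, dirac_order L q = k) ->
  exists V, [/\ open V, V p &
  exists (h : 'I_n -> M -> fibre C n), [/\
    forall k, smooth_complex V (h k),
    forall q, V q -> forall k, L q (h k q) /\ (im_fib (h k q)).1 = 0,
    forall q, V q -> forall l : 'I_n -> R,
      \sum_k l k *: tau (h k q) = 0 -> forall k, l k = 0 &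
    forall a, smooth_real V a -> (forall q, V q -> hat (L q) (a q)) ->
      exists l : 'I_n -> M -> R, (forall k, smooth_fun_on V (l k)) /\
        forall q, V q -> a q = \sum_k l k q *: tau (h k q)]].
Proof.
move=> [k0 order].
have [U [Uo Up [N [g [gs gL]]]]] := real_generators p.
set c := chart_at p; have cp : dom c p := mem_chart_at p.
have ac : atlas c := chart_at_atlas p.
pose U1 := U `&` dom c; have U1o : open U1 by apply: openI => //; exact: open_dom.
pose B q : 'M[R]_(N, n) := \matrix_j vec_in c q (im_fib (g j q)).1.
have Bs : smooth_mx U1 B.
  move=> j i.
  apply: (eq_smooth_fun_on (f := fun q => comp_in c q (im_fib (g j q)) 0
    (lshift n i))) => //.
    by move=> q _; rewrite row_mxEl [RHS]mxE.
  apply: comp_in_smooth => //; first by move=> ? [].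
  by have [_] := gs j; apply: smooth_real_sub => ? [].
have cB q (v : 'rV[R]_N) : v *m B q = vec_in c q (im_fib (rcomb (g^~ q) v)).1.
  rewrite im_rcomb fst_sumZ.
  rewrite (big_morph _ (vec_inD c q) (_ : _ = 0)); last by rewrite /vec_in mul0mx.
  by rewrite mulmx_sum_row; apply: eq_bigr => j _; rewrite rowK vec_inZ.
(* [B] is written in the chart [c] to be smooth; changing to the preferred chart at [q] multiplies
   it by an invertible Jacobian. *)
have rankB q : U1 q -> \rank (B q) = rank (D_of L q).
  move=> [Uq cq]; pose B0 : 'M[R]_(N, n) := \matrix_j (im_fib (g j q)).1.
  have BB0 : B q = B0 *m jac (chart_at q) c q.
    by apply/row_matrixP => j; rewrite row_mul !rowK.
  rewrite BB0 mxrankMfree; last first.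
    by apply/row_freeP; exists (jac c (chart_at q) q); exact: jac_chart_at.
  rewrite -rank_rowspace D_ofE // gL //; congr rank; apply/seteqP; split=> v /=.
    move=> /submxP[w ->]; exists (rcomb (g^~ q) w); first by exists w.
    rewrite [LHS](_ : _ = (im_fib (rcomb (g^~ q) w)).1) // im_rcomb.
    rewrite fst_sumZ.
    by rewrite mulmx_sum_row; apply: eq_bigr => j _; rewrite rowK.
  move=> [_ [w _ <-] <-]; rewrite [im_vec _](_ : _ =
    (im_fib (rcomb (g^~ q) w)).1) // im_rcomb.
  rewrite fst_sumZ.
  by apply/submxP; exists w; rewrite mulmx_sum_row; apply: eq_bigr => j _;
    rewrite rowK.
have U1p : U1 p by [].
have rank_cst q : U1 q -> \rank (B q) = \rank (B p).
  move=> U1q; have : dirac_order L q = dirac_order L p by rewrite !order.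
  rewrite /dirac_order -(rankB q U1q) -(rankB p U1p) => E.
  (* The order is a truncated difference; it determines the rank because ranks are at most [n]. *)
  have aux (i j : nat) : (i <= n)%N -> (j <= n)%N -> (n - i)%N = (n - j)%N ->
    i = j.
    by move=> li lj /(congr1 (subn n)); rewrite !subKn.
  exact: aux (rank_leq_col _) (rank_leq_col _) E.
have [T [S TBS]] := rank_inverses (B p).
have TBSs : smooth_mx U1 (fun q => T *m B q *m S).
  apply: smooth_mx_mul => //; last exact: smooth_mx_cst.
  by apply: smooth_mx_mul => //; exact: smooth_mx_cst.
pose U2 := U1 `&` [set q | \det (T *m B q *m S) != 0].
have U2o : open U2 by apply: open_neq0 => //; exact: smooth_det.
have U2u q : U2 q -> T *m B q *m S \in unitmx by move=> [_];
  rewrite unitmxE unitfE.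
have U2p : U2 p by split=> //=; rewrite TBS det1 oner_neq0.
have Ps : smooth_mx U2 (fun q => ker_proj T S (B q)).
  have sub k l (A : M -> 'M[R]_(k, l)) : smooth_mx U1 A -> smooth_mx U2 A.
    by move=> H i j; apply: smooth_fun_on_sub (H i j) => ? [].
  rewrite /ker_proj (_ : (fun q => _) = fun q =>
      1%:M + (-1) *: (B q *m S *m invmx (T *m B q *m S) *m T)); last first.
    by apply/funext => q; rewrite scaleN1r.
  apply: smooth_mx_add => //; first exact: smooth_mx_cst.
  apply: smooth_mx_scale => //; first exact: smooth_fun_on_cst.
  apply: smooth_mx_mul => //; last exact: smooth_mx_cst.
  apply: smooth_mx_mul => //; last by apply: smooth_invmx => //; exact: sub.
  by apply: smooth_mx_mul => //; [exact: sub|exact: smooth_mx_cst].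
have [W [WE dW]] := hat_vspace p.
pose b (k : 'I_n) := (vbasis W)`_k.
have bH k : exists v : 'rV[R]_N, v *m B p = 0 /\ b k = tau (rcomb (g^~ p) v).
  have : hat (L p) (b k) by rewrite WE /= vbasis_mem // mem_nth // size_tuple dW.
  move=> [l [+ l1 ->]]; rewrite gL // => -[v _ vl]; exists v; rewrite -vl in l1 *.
  by split; rewrite ?cB ?l1 // /vec_in mul0mx.
have [v0 v0P] := choice bH.
(* The coefficients found at [p] are projected onto the kernel of [B q]; at [p] they already lie in
   the kernel and do not change. *)
pose v k q := v0 k *m ker_proj T S (B q).
pose h k q := rcomb (g^~ q) (v k q).
have vB k q : U2 q -> v k q *m B q = 0.
  move=> U2q; have [U1q _] := U2q.
  by rewrite /v -mulmxA (ker_projP (rank_cst q U1q) (U2u q U2q)) mulmx0.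
have vs k : smooth_mx U2 (v k).
  by apply: smooth_mx_mul => //; exact: smooth_mx_cst.
have hs k : smooth_complex U2 (h k).
  split.
    apply: (eq_smooth_real (a := fun q => \sum_j v k q 0 j *: re_fib (g j q)))
      => //.
      by move=> q _; rewrite re_rcomb.
    apply: smooth_real_sum => // j; apply: smooth_real_scale => //;
      first exact: vs.
    by have [+ _] := gs j; apply: smooth_real_sub => ? [[]].
  apply: (eq_smooth_real (a := fun q => \sum_j v k q 0 j *: im_fib (g j q))) =>
    //.
    by move=> q _; rewrite im_rcomb.
  apply: smooth_real_sum => // j; apply: smooth_real_scale => //; first exact: vs.
  by have [_ +] := gs j; apply: smooth_real_sub => ? [[]].
have hL q : U2 q -> forall k, L q (h k q) /\ (im_fib (h k q)).1 = 0.
  move=> U2q k; have [[Uq cq] _] := U2q; split; first by rewrite gL //;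
    exists (v k q).
  by apply: (vec_in_eq0 ac cq); rewrite -cB vB.
have hp k : tau (h k p) = b k.
  by have [E ->] := v0P k; rewrite /h /v ker_proj_id.
have indep (l : 'I_n -> R) : \sum_k l k *: tau (h k p) = 0 -> forall k, l k = 0.
  have E : tval [tuple tau (h k p) | k < n] = tval (vbasis W).
    apply: (@eq_from_nth _ 0) => [|i]; rewrite !size_tuple ?dW // => ilt.
    apply: etrans (esym (tnth_nth 0 [tuple tau (h k p) | k < n] (Ordinal ilt))) _.
    by rewrite tnth_mktuple hp.
  have := basis_free (vbasisP W); rewrite -E => /free_familyP.
  exact.
have [V [Vo Vp VU2 Vindep Vco]] :=
  smooth_coordinates U2o U2p (fun k => tau_smooth U2o (hs k)) indep.
exists V; split=> //; exists h; split.
- by move=> k; have [H1 H2] := hs k; split;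
  [exact: smooth_real_sub H1|exact: smooth_real_sub H2].
- by move=> q /VU2; exact: hL.
- exact: Vindep.
- move=> a as_ aH; apply: Vco => // q Vq.
  have := aH q Vq; rewrite (hat_span (f := fun k => tau (h k q))).
  + by move=> /= /span_familyP.
  + by move=> k; have [H1 H2] := hL q (VU2 q Vq) k; exists (h k q).
  + exact: Vindep.
Qed.

End HatFrame.

(** * The Dorfman bracket *)

Section Bracket.
Variables (R : realType) (n : nat) (M : manifold R n).
Local Notation C := R[i].
Implicit Types (p q : M) (U V : set M) (X Y : M -> 'rV[R]_n).

Lemma near_icoord p V : open V -> V p ->
  \forall x \near coord (chart_at p) p,
    (coord (chart_at p) @` dom (chart_at p)) x /\ V (icoord (chart_at p) x).
Proof.
move=> Vo Vp; have cp := mem_chart_at p; set c := chart_at p.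
have : open_nbhs (coord c p) (coord c @` (V `&` dom c)).
  by split; [exact: open_imcoord|exists p].
by move=> /open_nbhs_nbhs; apply: filterS => x /imcoordP.
Qed.

Lemma eq_pd i p V (f g : M -> R) : open V -> V p -> (forall q, V q ->
  f q = g q) ->
  pd i f p = pd i g p.
Proof.
move=> Vo Vp fg; apply: near_eq_derive.
by apply: filterS (near_icoord Vo Vp) => x [_ /fg].
Qed.

Lemma pd_cst i p (k : R) : pd i (fun=> k) p = 0.
Proof. exact: derive_cst. Qed.

Lemma eq_dvec p V X Y i j : open V -> V p -> (forall q, V q -> X q = Y q) ->
  dvec X p i j = dvec Y p i j.
Proof. by move=> Vo Vp XY; apply: (eq_pd _ Vo Vp) => q /XY ->. Qed.

Lemma eq_dcov p V X Y i j : open V -> V p -> (forall q, V q -> X q = Y q) ->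
  dcov X p i j = dcov Y p i j.
Proof. by move=> Vo Vp XY; apply: (eq_pd _ Vo Vp) => q /XY ->. Qed.

Lemma dvec0 p V X i j : open V -> V p -> (forall q, V q -> X q = 0) ->
  dvec X p i j = 0.
Proof.
move=> Vo Vp X0; rewrite -(pd_cst i p 0); apply: (eq_pd _ Vo Vp) => q /X0 ->.
by rewrite /vec_in mul0mx mxE.
Qed.

Lemma eq_dorfman p V (a a' b b' : M -> fibre R n) : open V -> V p ->
  (forall q, V q -> a q = a' q) -> (forall q, V q -> b q = b' q) ->
  dorfman a b p = dorfman a' b' p.
Proof.
move=> Vo Vp aa bb.
have a1 q : V q -> (a q).1 = (a' q).1 by move=> /aa ->.
have a2 q : V q -> (a q).2 = (a' q).2 by move=> /aa ->.
have b1 q : V q -> (b q).1 = (b' q).1 by move=> /bb ->.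
have b2 q : V q -> (b q).2 = (b' q).2 by move=> /bb ->.
rewrite /dorfman; congr (_, _ - _); apply/rowP => j; rewrite !mxE;
  apply: eq_bigr => i _.
- by rewrite aa // bb // (eq_dvec _ _ Vo Vp a1) (eq_dvec _ _ Vo Vp b1).
- by rewrite aa // bb // (eq_dvec _ _ Vo Vp a1) (eq_dcov _ _ Vo Vp b2).
- by rewrite bb // !(eq_dcov _ _ Vo Vp a2).
Qed.

(** The imaginary vector parts have to vanish on a neighbourhood and not just at [p], as the bracket
    differentiates them. Every term containing one then drops out. *)
Lemma tau_dorfman p V (a b : M -> fibre C n) : open V -> V p ->
  (forall q, V q -> (im_fib (a q)).1 = 0) -> (forall q, V q ->
    (im_fib (b q)).1 = 0) ->
  tau (dorfman_complex a b p) = dorfman (fun q => tau (a q)) (fun q =>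
    tau (b q)) p /\
  (im_fib (dorfman_complex a b p)).1 = 0.
Proof.
move=> Vo Vp a0 b0.
have lie0 X Y : (forall q, V q -> X q = 0) ->
  lie_bracket X Y p = 0 /\ lie_bracket Y X p = 0.
  move=> X0; split; apply/rowP => j; rewrite !mxE; apply: big1 => i _;
    by rewrite (dvec0 _ _ Vo Vp X0) X0 // mxE mul0r mulr0 subrr.
have dc : dorfman_complex a b p = mk_fib
   (dorfman (fun q => re_fib (a q)) (fun q => re_fib (b q)) p -
    dorfman (fun q => im_fib (a q)) (fun q => im_fib (b q)) p)
   (dorfman (fun q => re_fib (a q)) (fun q => im_fib (b q)) p +
    dorfman (fun q => im_fib (a q)) (fun q => re_fib (b q)) p) by [].
rewrite /tau dc re_mk im_mk; split; last first.
  rewrite /dorfman /=; have [_ ->] := lie0 _ (fun q => (re_fib (a q)).1) b0.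
  by have [-> _] := lie0 _ (fun q => (re_fib (b q)).1) a0; rewrite addr0.
rewrite /dorfman /=; have [-> _] := lie0 _ (fun q => (im_fib (b q)).1) a0.
rewrite subr0; congr (_, _).
have c0 xi : contract_d (fun q => (im_fib (b q)).1) xi p = 0.
  apply/rowP => j; rewrite !mxE; apply: big1 => i _.
  by rewrite b0 // mxE mul0r.
have l0 xi : lie_derivative (fun q => (im_fib (a q)).1) xi p = 0.
  apply/rowP => j; rewrite !mxE; apply: big1 => i _.
  by rewrite (dvec0 _ _ Vo Vp a0) a0 // mxE mul0r mulr0 addr0.
by rewrite c0 l0 subr0 sub0r.
Qed.

Lemma smooth_complex_scale U (f : M -> R) (a : M -> fibre C n) : open U ->
  smooth_fun_on U f -> smooth_complex U a ->
  smooth_complex U (fun q => (f q)%:C%C *: a q).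
Proof.
move=> Uo fs [H1 H2]; split.
  apply: (eq_smooth_real Uo _ (smooth_real_scale Uo fs H1)) => q _.
  by rewrite re_fibZ /= scale0r subr0.
apply: (eq_smooth_real Uo _ (smooth_real_scale Uo fs H2)) => q _.
by rewrite im_fibZ /= scale0r addr0.
Qed.

Lemma smooth_complex_sum U r (a : 'I_r -> M -> fibre C n) : open U ->
  (forall i, smooth_complex U (a i)) -> smooth_complex U (fun q => \sum_i a i q).
Proof.
move=> Uo H; split.
  apply: (eq_smooth_real Uo _ (smooth_real_sum _ Uo (fun i => proj1 (H i)))) =>
    q _.
  by rewrite (big_morph _ (@re_fibD R n) (@re_fib0 R n)).
apply: (eq_smooth_real Uo _ (smooth_real_sum _ Uo (fun i => proj2 (H i)))) => q _.
by rewrite (big_morph _ (@im_fibD R n) (@im_fib0 R n)).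
Qed.

Variable L : M -> set (fibre C n).
Hypothesis dL : complex_dirac L.

Lemma lift_section p (a : M -> fibre R n) :
  (exists k, forall q, dirac_order L q = k) ->
  smooth_real setT a -> (forall q, hat (L q) (a q)) ->
  exists V b, [/\ open V, V p, global_section (@smooth_complex R n M) L b,
    forall q, V q -> a q = tau (b q) &
    forall q, V q -> (im_fib (b q)).1 = 0].
Proof.
move=> order as_ aH; have [sbL lagL _] := dL.
have [U [Uo Up [h [hs hL _ hco]]]] := hat_frame sbL lagL p order.
have [|q _|l [ls lE]] := hco a; first exact: smooth_real_sub as_.
  exact: aH.
have [f [V [W [fs [Vo Vp VU f1] [Wo UW f0]]]]] := bump Uo Up.
pose b q := \sum_k (l k q)%:C%C *: h k q.
have bs : smooth_complex U b.
  by apply: smooth_complex_sum => // k; exact: smooth_complex_scale.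
have bE q : b q = rcomb (h^~ q) (\row_k l k q).
  by apply: eq_bigr => k _; rewrite mxE.
have bL q : U q -> L q (b q).
  by move=> Uq; apply: lagr_sum => // k; have [] := hL q Uq k.
(* Membership of [b q] in [L q] is known only on [U]; [f] vanishes on [W], and [U] and [W] cover the
   manifold. *)
exists V, (fun q => (f q)%:C%C *: b q); split=> //.
- split; last first.
    move=> q; case: (UW q) => [/bL|/f0 ->]; first exact: lagrZ.
    by rewrite scale0r; exact: lagr0.
  have [b1 b2] := bs; split.
    apply: (eq_smooth_real openT _ (smooth_real_cutoff Uo Wo UW f0 fs b1)) => q _.
    by rewrite re_fibZ /= scale0r subr0.
  apply: (eq_smooth_real openT _ (smooth_real_cutoff Uo Wo UW f0 fs b2)) => q _.
  by rewrite im_fibZ /= scale0r addr0.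
- move=> q Vq; rewrite f1 // scale1r bE tau_rcomb lE; last exact: VU.
  by apply: eq_bigr => k _; rewrite mxE.
- move=> q Vq; rewrite f1 // scale1r bE im_rcomb.
  rewrite fst_sumZ.
  apply: big1 => k _; have [_] := hL q (VU q Vq) k => /= ->; exact: scaler0.
Qed.

Lemma hat_involutive : (exists k, forall q, dirac_order L q = k) ->
  involutive (@smooth_real R n M) (@dorfman R n M) (fun p => hat (L p)).
Proof.
move=> order a b [as_ aH] [bs bH]; have [_ _ inv] := dL.
have key p : exists V c, [/\ open V, V p, global_section (@smooth_complex R n
  M) L c,
    forall q, V q -> dorfman a b q = tau (c q) & (im_fib (c p)).1 = 0].
  have [V1 [a' [V1o V1p ga aE a0]]] := lift_section p order as_ aH.
  have [V2 [b' [V2o V2p gb bE b0]]] := lift_section p order bs bH.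
  have Vo : open (V1 `&` V2) by exact: openI.
  have D q (Vq : (V1 `&` V2) q) := @tau_dorfman q _ a' b' Vo Vq
    (fun q' (H : (V1 `&` V2) q') => a0 q' (proj1 H)) (fun q' H =>
      b0 q' (proj2 H)).
  exists (V1 `&` V2), (dorfman_complex a' b'); split=> //.
  - exact: inv.
  - move=> q Vq; have [-> _] := D q Vq; apply: (eq_dorfman Vo Vq) => q' [H1 H2].
      exact: aE.
    exact: bE.
  - by have [] := D p (conj V1p V2p).
split=> [|p].
  apply: smooth_real_local => p _; have [V [c [Vo Vp [cs _] E _]]] := key p.
  exists V; split=> //; have [c1 c2] := cs.
  apply: (eq_smooth_real Vo (a := fun q => tau (c q))); first by move=> q /E.
  apply: tau_smooth => //; split; [exact: smooth_real_sub c1|exact: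
    smooth_real_sub c2].
have [V [c [Vo Vp [_ cL] E c0]]] := key p.
by rewrite E //; exists (c p).
Qed.

Lemma hat_real_dirac : (exists k, forall q, dirac_order L q = k) ->
  real_dirac (hat_L L).
Proof.
move=> order; have [sbL lagL _] := dL.
rewrite (_ : hat_L L = fun p => hat (L p)); last by apply/funext => p;
  exact: hat_LE.
split; last exact: hat_involutive.
  move=> p; have [V [Vo Vp [h [hs hL hi _]]]] := hat_frame sbL lagL p order.
  exists V; split=> //; split=> //; exists n, (fun k q => tau (h k q)); split.
    by move=> k; exact: tau_smooth.
  move=> q Vq; split; first by apply/free_familyP; exact: hi.
  by apply: hat_span => //; [move=> k; have [H1 H2] := hL q Vq k;
    exists (h k q)|exact: hi].
by move=> p; exact: hat_lagrangian.
Qed.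

End Bracket.

(** * Generalized complex structures *)

Section GeneralizedComplex.
Variables (R : realType) (n : nat) (M : manifold R n).
Local Notation C := R[i].
Implicit Types (p q : M) (U V : set M).
Variable L : M -> set (fibre C n).

Lemma re_conj (a : fibre C n) : re_fib (conj_fib a) = re_fib a.
Proof. by congr (_, _); apply/rowP => i; rewrite !mxE;
  [case: (a.1 0 i)|case: (a.2 0 i)]. Qed.
Lemma im_conj (a : fibre C n) : im_fib (conj_fib a) = - im_fib a.
Proof. by congr (_, _); apply/rowP => i; rewrite !mxE;
  [case: (a.1 0 i)|case: (a.2 0 i)]. Qed.

Lemma re_fibN (a : fibre C n) : re_fib (- a) = - re_fib a.
Proof. by congr (_, _); apply/rowP => i; rewrite !mxE;
  [case: (a.1 0 i)|case: (a.2 0 i)]. Qed.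
Lemma im_fibN (a : fibre C n) : im_fib (- a) = - im_fib a.
Proof. by congr (_, _); apply/rowP => i; rewrite !mxE;
  [case: (a.1 0 i)|case: (a.2 0 i)]. Qed.

Lemma conj_fib_lin k (a b : fibre C n) : conj_fib (k *: a + b) =
  (k^*)%C *: conj_fib a + conj_fib b.
Proof. by congr (_, _); apply/rowP => i; rewrite !mxE rmorphD rmorphM. Qed.

(** A purely imaginary [l] has conjugate [- l], so it lies in L and in its conjugate. The
    intersection is first shown to be a subspace, since [rank] reads the dimension off a subspace
    equal to the given set. *)
Lemma real_index_eq0 p (l : fibre C n) : lagrangian L -> real_index L p = 0%N ->
  L p l -> re_fib l = 0 -> l = 0.
Proof.
move=> lagL; rewrite /real_index; set S := _ `&` _ => S0 Ll l0.
have [||W SW] := @linear_set_vspace _ _ S.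
- split; first exact: lagr0.
  exists 0; first exact: lagr0.
  by apply: fib_ext; rewrite ?re_conj ?im_conj ?im_fib0 ?oppr0.
- move=> k a b [La [a' La' Ea]] [Lb [b' Lb' Eb]]; split; first exact: lagr_lin.
  exists ((k^*)%C *: a' + b'); first exact: lagr_lin.
  rewrite -Ea -Eb.
  by rewrite conj_fib_lin conjcK.
have lS : S l.
  split=> //; exists (- l); first by rewrite -scaleN1r; exact: lagrZ.
  by apply: fib_ext; rewrite ?re_conj ?im_conj ?re_fibN ?im_fibN ?l0 ?oppr0
    ?opprK.
move: S0 lS; rewrite SW rank_vspace => /eqP; rewrite dimv_eq0 => /eqP -> /=.
by rewrite memv0 => /eqP.
Qed.

Hypothesis sbL : smooth_subbundle (@smooth_complex R n M) L.
Hypothesis lagL : lagrangian L.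
Hypothesis indexL : forall p, real_index L p = 0%N.

(** A local frame of L has [n] elements because L is lagrangian. A real relation between their real
    and imaginary parts is an element of L with zero real part, hence trivial, and 2n independent
    vectors fill the fibre. *)
Lemma real_frame p : exists U, [/\ open U, U p &
  exists (e : 'I_n -> M -> fibre C n), [/\
    forall i, smooth_complex U (e i),
    forall q, U q -> forall i, L q (e i q),
    forall q, U q -> forall s t : 'I_n -> R,
      \sum_i (s i *: re_fib (e i q) + t i *: im_fib (e i q)) = 0 ->
      forall i, s i = 0 /\ t i = 0 &
    forall q, U q -> forall u, exists s t : 'I_n -> R,
      u = \sum_i (s i *: re_fib (e i q) + t i *: im_fib (e i q))]].
Proof.
have [U [Uo [Up [r [e [es eL]]]]]] := sbL p.
have rn : r = n.
  have [f Lp] := eL p Up.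
  have <- := lagrangian_dim (@two_neq0 C) (etrans (esym Lp) (etrans (lagL p)
    (congr1 (@orth _ _) Lp))).
  by have /eqP -> := f; rewrite size_tuple.
subst r; exists U; split=> //; exists e.
have Le q : U q -> forall i, L q (e i q).
  move=> Uq i; have [_ ->] := eL q Uq; apply: memv_span; apply/mapP.
  by exists i; rewrite ?mem_enum.
have indep q : U q -> forall s t : 'I_n -> R,
      \sum_i (s i *: re_fib (e i q) + t i *: im_fib (e i q)) = 0 ->
      forall i, s i = 0 /\ t i = 0.
  (* The sign is chosen so that the real part of (s - i t) e is s Re e + t Im e. *)
  move=> Uq s t st0; pose z i : C := Complex (s i) (- t i).
  have z0 : \sum_i z i *: e i q = 0.
    apply: (real_index_eq0 lagL (indexL q)).
      by apply: lagr_sum => // i; exact: Le.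
    by rewrite re_fib_sum -[RHS]st0; apply: eq_bigr => i _ /=;
      rewrite scaleNr opprK.
  have [/free_familyP F _] := eL q Uq; move=> i; have := F z z0 i.
  by move=> /eqP; rewrite eq_complex /= oppr_eq0 => /andP[/eqP -> /eqP ->].
split=> // q Uq u.
pose g (j : 'I_(n + n)) := match fintype.split j with
  inl i => re_fib (e i q) | inr i => im_fib (e i q) end.
have gE (c : 'I_(n + n) -> R) : \sum_j c j *: g j =
    \sum_i (c (lshift n i) *: re_fib (e i q) + c (rshift n i) *: im_fib (e i q)).
  rewrite big_split_ord /= -big_split /=; apply: eq_bigr => i _.
  by rewrite /g (unsplitK (inl i)) (unsplitK (inr i)).
have gfree : free [tuple g j | j < n + n].
  apply/free_familyP => c; rewrite gE => /(indep q Uq) c0 j.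
  by case: (split_ordP j) => i ->; have [] := c0 i.
have : u \in <<[tuple g j | j < n + n]>>%VS.
  suff -> : <<[tuple g j | j < n + n]>>%VS = fullv by rewrite memvf.
  apply/eqP; rewrite eqEdim subvf /=; have /eqP -> := gfree.
  by rewrite size_tuple dimvf /dim /= /dim /= !mul1n.
move=> /span_familyP[c ->]; exists (fun i => c (lshift n i)), (fun i =>
  c (rshift n i)).
exact: gE.
Qed.

Lemma re_surj p u : exists l, L p l /\ re_fib l = u.
Proof.
have [U [_ Up [e [_ Le _ span]]]] := real_frame p.
have [s [t ->]] := span p Up u; pose z i : C := Complex (s i) (- t i).
exists (\sum_i z i *: e i p); split.
  by apply: lagr_sum => // i; exact: Le.
by rewrite re_fib_sum; apply: eq_bigr => i _ /=; rewrite scaleNr opprK.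
Qed.

Lemma re_inj p l m : L p l -> L p m -> re_fib l = re_fib m -> l = m.
Proof.
move=> Ll Lm E; apply/eqP; rewrite -subr_eq0; apply/eqP.
apply: (real_index_eq0 lagL (indexL p)); last by rewrite re_fibD re_fibN E subrr.
by rewrite addrC -scaleN1r; exact: lagr_lin.
Qed.

(** The lift picked by [xget] exists by [re_surj] and is unique by [re_inj]. *)
Definition gc_fun p (u : fibre R n) : fibre R n :=
  - im_fib (xget 0 [set l | L p l /\ re_fib l = u]).

Lemma gc_funE p l : L p l -> gc_fun p (re_fib l) = - im_fib l.
Proof.
move=> Ll; rewrite /gc_fun; case: xgetP => [m _ [Lm E]|/(_ l)[]//].
by rewrite (re_inj Lm Ll E).
Qed.

Lemma gc_fun_linear p : linear (gc_fun p).
Proof.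
move=> k u v; have [l [Ll <-]] := re_surj p u; have [m [Lm <-]] := re_surj p v.
have Lklm : L p (k%:C%C *: l + m) by exact: lagr_lin.
rewrite (_ : k *: re_fib l + re_fib m = re_fib (k%:C%C *: l + m)).
  rewrite !gc_funE // im_fibD im_fibZ /= scale0r addr0 opprD scalerN //.
by rewrite re_fibD re_fibZ /= scale0r subr0.
Qed.

Definition gc_map p : 'End(fibre R n) :=
  linfun (HB.pack_for {linear fibre R n -> fibre R n} (gc_fun p)
    (GRing.isLinear.Build _ _ _ _ (gc_fun p) (gc_fun_linear p))).

Lemma gc_mapE p l : L p l -> gc_map p (re_fib l) = - im_fib l.
Proof. by move=> Ll; rewrite lfunE; exact: gc_funE. Qed.

Lemma gc_map_im p l : L p l -> gc_map p (im_fib l) = re_fib l.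
Proof.
move=> Ll; have Lil : L p ('i%C *: l) by exact: lagrZ.
have := gc_mapE Lil; rewrite re_iZ im_iZ linearN => /eqP.
by rewrite eqr_opp => /eqP.
Qed.

Lemma i_eigenbundleP (J : M -> 'End(fibre R n)) p a :
  i_eigenbundle J p a <-> J p (re_fib a) = - im_fib a /\ J p (im_fib a) =
    re_fib a.
Proof.
have E : complexify (J p) a = mk_fib (J p (re_fib a)) (J p (im_fib a)) by [].
rewrite /i_eigenbundle /= E; split=> [H|[H1 H2]].
  by split; [rewrite -re_iZ -H re_mk|rewrite -[RHS]im_iZ -H im_mk].
by apply: fib_ext; rewrite ?re_mk ?im_mk ?re_iZ ?im_iZ.
Qed.

Lemma gc_eigenbundle p : L p = i_eigenbundle gc_map p.
Proof.
apply/seteqP; split=> a.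
  by move=> La; apply/i_eigenbundleP; rewrite gc_mapE // gc_map_im.
move=> /i_eigenbundleP[H _]; have [l [Ll E]] := re_surj p (re_fib a).
move: H; rewrite -E gc_mapE // => /oppr_inj Ei.
by rewrite -(fib_ext E Ei).
Qed.

(** In the frame of real and imaginary parts of a local frame of L, the map has constant
    coefficients: it sends Re e to - Im e and Im e to Re e. Coefficients of a smooth section in this
    frame are smooth. *)
Lemma gc_map_smooth : smooth_bundle_map gc_map.
Proof.
move=> U a Uo as_; apply: smooth_real_local => p Up.
have [U1 [U1o U1p [e [es Le indep span]]]] := real_frame p.
pose g (j : 'I_(n + n)) q := match fintype.split j with
  inl i => re_fib (e i q) | inr i => im_fib (e i q) end.
have gE (c : 'I_(n + n) -> R) q : \sum_j c j *: g j q =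
    \sum_i (c (lshift n i) *: re_fib (e i q) + c (rshift n i) *: im_fib (e i q)).
  rewrite big_split_ord /= -big_split /=; apply: eq_bigr => i _.
  by rewrite /g (unsplitK (inl i)) (unsplitK (inr i)).
have gs j : smooth_real U1 (g j).
  by rewrite /g; case: (fintype.split j) => i; have [] := es i.
have gi (c : 'I_(n + n) -> R) : \sum_j c j *: g j p = 0 -> forall j, c j = 0.
  rewrite gE => /(indep p U1p) c0 j.
  by case: (split_ordP j) => i ->; have [] := c0 i.
have [V [Vo Vp VU _ Vco]] := smooth_coordinates U1o U1p gs gi.
have UVo : open (U `&` V) by exact: openI.
have [||q [_ /VU U1q]|c [cs cE]] := Vco (U `&` V) a UVo.
- by move=> ? [].
- by apply: smooth_real_sub as_ => ? [].
- have [s [t E]] := span q U1q (a q).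
  exists (fun j => match fintype.split j with inl i => s i | inr i => t i end).
  rewrite gE E; apply: eq_bigr => i _.
  by rewrite (unsplitK (inl i)) (unsplitK (inr i)).
exists (U `&` V); split=> //.
apply: (eq_smooth_real UVo (a := fun q => \sum_i
  (c (lshift n i) q *: (- im_fib (e i q)) + c (rshift n i) q *: re_fib (e i q)))).
  move=> q [Uq Vq]; rewrite cE // gE linear_sum; apply: eq_bigr => i _.
  have Lei := Le q (VU q Vq) i.
  by rewrite linearD !linearZ /= gc_mapE // gc_map_im.
have VU1 : U `&` V `<=` U1 by move=> q [_ /VU].
apply: smooth_real_sum => // i; apply: smooth_real_add => //.
  apply: smooth_real_scale => //; apply: smooth_real_opp => //.
  by have [_] := es i; exact: smooth_real_sub.
apply: smooth_real_scale => //.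
by have [+ _] := es i; exact: smooth_real_sub.
Qed.

Lemma gc_map_generalized_complex :
  involutive (@smooth_complex R n M) (@dorfman_complex R n M) L ->
  generalized_complex gc_map.
Proof.
move=> inv; split.
- exact: gc_map_smooth.
- move=> p u; have [l [Ll <-]] := re_surj p u.
  by rewrite (gc_mapE Ll) linearN /= (gc_map_im Ll).
(* Skew-symmetry is the vanishing of the imaginary part of the pairing of the lifts [l] and [m]. *)
- move=> p u v; have [l [Ll <-]] := re_surj p u; have [m [Lm <-]] := re_surj p v.
  rewrite !gc_mapE // pairingNl pairingNr.
  have lm : pairing l m = 0 by move: Ll; rewrite lagL => /(_ _ Lm).
  have := Im_pairing l m; rewrite lm /= => /esym/eqP.
  by rewrite addrC addr_eq0 => /eqP ->.
- by rewrite (_ : i_eigenbundle gc_map = L) //; apply/funext => p;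
  rewrite gc_eigenbundle.
Qed.

End GeneralizedComplex.

(** * The Poisson bivector *)

Section Poisson.
Variables (R : realType) (n : nat) (M : manifold R n).
Local Notation C := R[i].
Implicit Types (p q : M) (U V : set M) (f g h : M -> R).

(** The chain rule compensates for [d_of] using a different chart at each point; in a fixed chart
    the components become partial derivatives of one function, hence smooth. *)
Lemma cov_in_d_of (c : chart R n M) q f : atlas c -> dom c q -> smooth_fun f ->
  cov_in c q (d_of f q) = \row_i 'D_(delta_mx 0 i) (fun x =>
    f (icoord c x)) (coord c q).
Proof.
move=> ac cq fs; set d := chart_at q; have ad : atlas d := chart_at_atlas q.
have dq : dom d q := mem_chart_at q.
apply/rowP => i; rewrite [RHS]mxE.
have E : \forall x \near coord c q, f (icoord c x) =
  f (icoord d (coord d (icoord c x))).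
  by apply: filterS (near_chart cq dq) => x [_ dx]; rewrite coordK.
have trd : differentiable (fun x => coord d (icoord c x)) (coord c q).
  exact: differentiable_transition.
have trdj j : differentiable (fun x => coord d (icoord c x) 0 j) (coord c q).
  by apply: smooth_on_differentiable (atlas_compatible ac ad j) _; exists q.
rewrite (near_eq_derive _ E).
rewrite (derive_comp (f := fun y => f (icoord d y)) (h := fun x =>
  coord d (icoord c x))) //.
  rewrite mxE; apply: eq_bigr => j _; rewrite coordK // mxE [X in _ * X]mxE /pd
    -/d.
  congr (_ * _).
  have := jacE (delta_mx 0 i) ac ad cq dq; rewrite -rowE => /rowP/(_ j).
  by rewrite mxE => ->; rewrite derive_mx ?mxE //; exact: diff_derivable.
rewrite coordK //; apply: smooth_on_differentiable (fs d ad) _.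
by exists q.
Qed.

Lemma smooth_cov_d_of f : smooth_fun f -> smooth_cov setT (d_of f).
Proof.
move=> fs c ac j.
have S := smooth_on_derive j (fs c ac).
apply: eq_smooth_on (smooth_on_sub _ S); first by apply: open_imcoord;
  exact: openT.
  move=> x /imcoordP[cx _]; rewrite cov_in_d_of //; last exact: icoord_dom.
  by rewrite mxE icoordK.
by move=> x /imcoordP[].
Qed.

(** By [ev_in] the evaluation may be computed near [p] in the preferred chart at [p], where the
    product rule yields exactly [dcov] and [dvec]. *)
Lemma derive_ev p (xi X : M -> 'rV[R]_n) i : smooth_cov setT xi ->
  smooth_vec setT X ->
  is_derive (coord (chart_at p) p) (delta_mx 0 i)
    (fun x => ev (xi (icoord (chart_at p) x)) (X (icoord (chart_at p) x)))
    (\sum_j (dcov xi p i j * X p 0 j + xi p 0 j * dvec X p i j)).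
Proof.
move=> xs Xs; set c := chart_at p; have ac : atlas c := chart_at_atlas p.
have cp : dom c p := mem_chart_at p.
pose a j x : R := cov_in c (icoord c x) (xi (icoord c x)) 0 j.
pose b j x : R := vec_in c (icoord c x) (X (icoord c x)) 0 j.
have xp : (coord c @` (setT `&` dom c)) (coord c p) by exists p.
have da j : differentiable (a j) (coord c p) by apply: smooth_on_differentiable
  (xs c ac j) _.
have db j : differentiable (b j) (coord c p) by apply: smooth_on_differentiable
  (Xs c ac j) _.
have E : \forall x \near coord c p, (\sum_(j < n) (a j * b j)) x =
    ev (xi (icoord c x)) (X (icoord c x)).
  apply: filterS (near_chart cp cp) => x [_ cx].
  by rewrite fct_sumE -(ev_in (xi (icoord c x)) (X (icoord c x)) ac cx).
have dab j : derivable (a j * b j) (coord c p) (delta_mx 0 i).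
  by apply: derivableM; exact: diff_derivable.
apply: (near_eq_is_derive E); apply: DeriveDef; first exact: derivable_sum.
rewrite derive_sum //; apply: eq_bigr => j _.
rewrite deriveM; [|exact: diff_derivable..].
have aE : a j (coord c p) = xi p 0 j by rewrite /a coordK // cov_in_chart_at.
have bE : b j (coord c p) = X p 0 j by rewrite /b coordK // vec_in_chart_at.
by rewrite aE bE addrC [X in X + _ = _]mulrC.
Qed.

(** Symmetry of second derivatives, that is, d(df) = 0. *)
Lemma dcov_d_of_sym f p i j : smooth_fun f ->
  dcov (d_of f) p i j = dcov (d_of f) p j i.
Proof.
move=> fs; set c := chart_at p; have ac : atlas c := chart_at_atlas p.
have cp : dom c p := mem_chart_at p.
have E k l : dcov (d_of f) p k l = 'D_(delta_mx 0 k)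
    ('D_(delta_mx 0 l) (fun x => f (icoord c x))) (coord c p).
  apply: near_eq_derive; apply: filterS (near_chart cp cp) => x [cx dx].
  by rewrite cov_in_d_of // mxE icoordK.
rewrite !E; apply: partialC (fs c ac) _; first exact: open_codom.
by exists p.
Qed.

Variable J : M -> 'End(fibre R n).
Hypothesis Js : smooth_bundle_map J.
Hypothesis Jskew : forall p a b, pairing (J p a) b = - pairing a (J p b).
Let pi := bivector_of J.

Lemma bivector_smooth U xi : open U -> smooth_cov U xi ->
  smooth_vec U (fun p => pi p (xi p)).
Proof.
move=> Uo xs; have [] // : smooth_real U (fun p => J p (0, xi p)).
apply: Js => //; split=> //.
by have [] := @smooth_real0 R n M U.
Qed.

Lemma bivector_linear p : linear (pi p).
Proof.
move=> k u v; rewrite /pi /bivector_of.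
rewrite (_ : (0, _) = k *: (0, u) + (0, v) :> fibre R n) ?linearP //.
by congr (_, _); rewrite /= scaler0 addr0.
Qed.

Lemma bivector_skew p xi eta : ev eta (pi p xi) = - ev xi (pi p eta).
Proof.
have := Jskew p (0, xi) (0, eta).
rewrite /pairing /= !ev0r addr0 add0r -mulrN => H.
apply: (@mulfI _ (2%:R^-1 : R)); first by rewrite invr_eq0 two_neq0.
exact: H.
Qed.

Lemma hamiltonian_smooth f : smooth_fun f ->
  smooth_real setT (fun q => (pi q (d_of f q), d_of f q)).
Proof.
move=> fs; have ds := smooth_cov_d_of fs; split=> //.
by apply: bivector_smooth => //; exact: openT.
Qed.

Lemma pd_poisson_bracket g h p i : smooth_fun g -> smooth_fun h ->
  is_derive (coord (chart_at p) p) (delta_mx 0 i)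
    (fun x => poisson_bracket pi g h (icoord (chart_at p) x))
    (\sum_j (dcov (d_of h) p i j * pi p (d_of g p) 0 j +
       d_of h p 0 j * dvec (fun q => pi q (d_of g q)) p i j)).
Proof.
move=> gs hs; have [Xs _] := hamiltonian_smooth gs.
exact: (derive_ev p i (smooth_cov_d_of hs) Xs).
Qed.

Lemma poisson_bracket2 f g h p : smooth_fun g -> smooth_fun h ->
  poisson_bracket pi f (poisson_bracket pi g h) p =
  \sum_i \sum_j (dcov (d_of h) p i j * pi p (d_of g p) 0 j +
    d_of h p 0 j * dvec (fun q => pi q (d_of g q)) p i j) * pi p (d_of f p) 0 i.
Proof.
move=> gs hs; apply: eq_bigr => i _; rewrite mxE /pd.
by have [_ ->] := pd_poisson_bracket p i gs hs; rewrite mulr_suml.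
Qed.

Lemma poisson_bracketN f g h p : smooth_fun g -> smooth_fun h ->
  poisson_bracket pi f (poisson_bracket pi h g) p =
  - poisson_bracket pi f (poisson_bracket pi g h) p.
Proof.
move=> gs hs; rewrite /poisson_bracket -evNl; congr (ev _ _); apply/rowP => i.
rewrite !mxE /pd.
have [dgh _] := pd_poisson_bracket p i gs hs.
rewrite -deriveN //; congr (derive _ _ _); apply/funext => x /=.
by rewrite !fctE /= bivector_skew.
Qed.

Lemma poisson_jacobi f g h p :
  involutive (@smooth_real R n M) (@dorfman R n M) (graph_of pi) ->
  smooth_fun f -> smooth_fun g -> smooth_fun h ->
  poisson_bracket pi f (poisson_bracket pi g h) p +
  poisson_bracket pi g (poisson_bracket pi h f) p +
  poisson_bracket pi h (poisson_bracket pi f g) p = 0.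
Proof.
move=> inv fs gs hs.
have sect k : smooth_fun k ->
    global_section (@smooth_real R n M) (graph_of pi) (fun q =>
      (pi q (d_of k q), d_of k q)).
  by move=> ks; split; [exact: hamiltonian_smooth|move=> q; exists (d_of k q)].
have [_ /(_ p)[alpha _ E]] := inv _ _ (sect f fs) (sect g gs).
(* The bracket of two sections of the graph is orthogonal to the graph. *)
have iso : ev (d_of h p) (pi p alpha) + ev alpha (pi p (d_of h p)) = 0.
  by rewrite (bivector_skew p alpha) addNr.
move: E => /= [E1 E2]; rewrite E1 E2 in iso.
rewrite (poisson_bracketN g p fs hs) !poisson_bracket2 // -[RHS]iso.
set F := pi p (d_of f p); set G := pi p (d_of g p); set X := pi p (d_of h p).
set dG := dvec (fun q => pi q (d_of g q)) p;
  set dF := dvec (fun q => pi q (d_of f q)) p.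
(* Here [F] and [G] are the values at [p] of the hamiltonian fields of [f] and [g]. The first two
   brackets form the commutator of these fields applied to [h]. The third is d{f, g} on the
   hamiltonian vector of [h], and d{f, g} is the Lie derivative of dg, as the contraction of d(df)
   vanishes. *)
rewrite /ev; congr (_ + _).
  have -> : \sum_i d_of h p 0 i * lie_bracket (fun q => pi q (d_of f q))
      (fun q => pi q (d_of g q)) p 0 i =
      \sum_i \sum_j d_of h p 0 j * (F 0 i * dG i j - G 0 i * dF i j).
    rewrite exchange_big; apply: eq_bigr => j _;
      rewrite [X in _ * X]mxE mulr_sumr.
    by apply: eq_bigr => i _.
  have -> : \sum_i \sum_j (dcov (d_of h) p i j * F 0 j + d_of h p 0 j * dF i j)
    * G 0 i =
     \sum_i \sum_j (dcov (d_of h) p i j * F 0 i * G 0 j + d_of h p 0 j * dF i j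
       * G 0 i).
    under eq_bigr do under eq_bigr do rewrite mulrDl.
    under [RHS]eq_bigr do rewrite big_split; rewrite [RHS]big_split /=.
    under eq_bigr do rewrite big_split; rewrite big_split /=; congr (_ + _).
    (* Exchanging indices in the second-derivative term of [h], which is symmetric, makes it match
       the one from the other bracket, so the two cancel. *)
    rewrite exchange_big; apply: eq_bigr => i _; apply: eq_bigr => j _.
    by rewrite dcov_d_of_sym //.
  rewrite -sumrB; apply: eq_bigr => i _; rewrite -sumrB; apply: eq_bigr => j _.
  by ring.
apply: eq_bigr => i _; rewrite [X in _ = X * _]mxE [X in _ = (_ + X) * _]mxE.
rewrite [X in _ = (_ - X) * _]mxE [X in _ =
  (X - _) * _]mxE [X in _ - X]big1 ?subr0; last first.
  by move=> j _; rewrite (dcov_d_of_sym p _ _ fs) subrr mulr0.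
rewrite mulr_suml; apply: eq_bigr => j _; rewrite (dcov_d_of_sym p i j gs) -/dF.
by ring.
Qed.

Lemma graph_eigenbundle (L : M -> set (fibre C n)) p :
  (forall u, J p (J p u) = - u) ->
  L p = i_eigenbundle J p -> hat (L p) = graph_of pi p.
Proof.
move=> JJ LE; apply/seteqP; split=> [_ [l [Ll l0 ->]]|_ [al _ <-]].
  move: Ll; rewrite LE => /i_eigenbundleP[_ Jim]; exists (im_fib l).2 => //.
  congr (_, _); rewrite /pi /bivector_of -Jim.
  by congr ((J p _).1); rewrite [RHS]surjective_pairing l0.
exists (mk_fib (J p (0, al)) (0, al)); rewrite re_mk im_mk; split=> //.
by rewrite LE; apply/i_eigenbundleP; rewrite re_mk im_mk JJ.
Qed.

End Poisson.

Theorem theorem5p1 (R : realType) (n : nat) (M : manifold R n)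
    (L : M -> set (fibre R[i] n)) :
  complex_dirac L ->
  (exists k : nat, forall p : M, dirac_order L p = k) ->
  real_dirac (hat_L L) /\
  ((forall p : M, real_index L p = 0%N) ->
    (exists J : M -> 'End(fibre R n),
      generalized_complex J /\ forall p : M, L p = i_eigenbundle J p) /\
    (forall J : M -> 'End(fibre R n),
      generalized_complex J -> (forall p : M, L p = i_eigenbundle J p) ->
      is_poisson (bivector_of J) /\ forall p : M, hat_L L p = graph_of (bivector_of J) p)).
Proof.
move=> dL order; have hatD := hat_real_dirac dL order.
have [sbL lagL invL] := dL; split=> // index0; split.
  exists (gc_map sbL lagL index0); split; last exact: gc_eigenbundle.
  exact: gc_map_generalized_complex.
move=> J [Js JJ Jskew _] LE.
have graph p : hat_L L p = graph_of (bivector_of J) p.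
  by rewrite hat_LE //; apply: graph_eigenbundle.
split=> //; split.
- by move=> U xi Uo; exact: bivector_smooth.
- exact: bivector_linear.
- exact: bivector_skew.
(* Involutivity of the graph comes from the first half of the theorem, since the graph is
   [hat_L L]. *)
- move=> f g h fs gs hs p; apply: poisson_jacobi => //.
  rewrite (_ : graph_of (bivector_of J) = hat_L L); first by have [] := hatD.
  by apply/funext => q; rewrite graph.
Qed.
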